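(* Let $k_1,\ldots,k_n$ be nonnegative integers whose sum is $m$. Then for any complex $L^p(\mu)$ space $$\mathbb{C}(k_1,\ldots,k_n;L^p(\mu))\le\begin{cases}\left(\dfrac{m^m}{k_1^{k_1}\cdots k_n^{k_n}}\right)^{1/p}\dfrac{k_1!\cdots k_n!}{m!} & \text{if } 1\le p\le m',\\[2ex] \left(\dfrac{m^m}{k_1^{k_1}\cdots k_n^{k_n}}\right)^{1/p'}\dfrac{k_1!\cdots k_n!}{m!} & \text{if } m\le p\le\infty.\end{cases}$$ In the case $1\le p\le m'$ the estimate is best possible, i.e. no smaller constant is valid for all complex $L^p(\mu)$ spaces.
   Context: Let $X$ be a complex Banach space with closed unit ball $B_X$. $\mathcal{L}^s({}^mX;\mathbb{C})$ denotes the space of continuous symmetric $m$-linear forms $L:X^m\to\mathbb{C}$. For such $L$, $\widehat{L}(x)=L(x,\ldots,x)$ and $\|\widehat{L}\|=\sup_{x\in B_X}|\widehat{L}(x)|$. For nonnegative integers $k_1,\ldots,k_n$ with sum $m\ge1$, $L(x_1^{k_1}\ldots x_n^{k_n})$ denotes the value of $L$ with $x_i$ placed in $k_i$ of the coordinates. Define $$\mathbb{C}(k_1,\ldots,k_n;X)=\inf\Big\{M>0:\ \sup_{x_1,\ldots,x_n\in B_X}|L(x_1^{k_1}\ldots x_n^{k_n})|\le M\|\widehat{L}\|\ \ \forall L\in\mathcal{L}^s({}^mX;\mathbb{C})\Big\}.$$ $m'=m/(m-1)$ and $p'=p/(p-1)$ are the conjugate exponents of $m$ and $p$ (with $1'=\infty$,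 $\infty'=1$). Convention: $0^0=1$. $\mu$ is an arbitrary measure. *)

(* Defs.v *)
From HB Require Import structures.
From mathcomp Require Import all_boot all_order all_algebra.
From mathcomp Require Import perm.
From mathcomp Require Import generic_quotient ring_quotient.
From mathcomp Require Import complex.
From mathcomp Require Import all_classical all_reals all_analysis.
From mathcomp Require Import measurable_realfun ess_sup_inf.

Set Implicit Arguments.
Unset Strict Implicit.
Unset Printing Implicit Defensive.
Import Order.TTheory GRing.Theory Num.Theory.
Import numFieldNormedType.Exports.

Local Open Scope classical_set_scope.
Local Open Scope ring_scope.

(* The complex space L^p(mu), 1 <= p <= +oo, as a normed module over R[i]:
   measurable functions T -> R[i] of finite p-norm, modulo equality mu-a.e.
   The library's 'N[mu]_p[_] and Lspace handle real-valued functions only. *)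
Section ComplexLp.
Context d (T : measurableType d) (R : realType).
Variables (mu : {measure set T -> \bar R}) (p : \bar R).

Definition cmeasurable (f : T -> R[i]) : Prop :=
  measurable_fun [set: T] (fun t => complex.Re (f t)) /\
  measurable_fun [set: T] (fun t => complex.Im (f t)).

Definition cLnorm (f : T -> R[i]) : \bar R :=
  'N[mu]_p[EFin \o (fun t => Normc.normc (f t))]%E.

Lemma normc_ge0 (z : R[i]) : 0 <= Normc.normc z.
Proof. by case: z => a b /=; exact: sqrtr_ge0. Qed.

Lemma norm_complexE (z : R[i]) : `|z| = (Normc.normc z)%:C%C.
Proof. by []. Qed.

Lemma ler_normcD (x y : R[i]) :
  Normc.normc (x + y) <= Normc.normc x + Normc.normc y.
Proof. by have := ler_normD x y; rewrite !norm_complexE -rmorphD/= lecR. Qed.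

Lemma measurable_normc (f : T -> R[i]) : cmeasurable f ->
  measurable_fun [set: T] (fun t => Normc.normc (f t)).
Proof.
move=> [mr mi].
rewrite (_ : (fun t => _) = (fun t =>
    (complex.Re (f t) ^+ 2 + complex.Im (f t) ^+ 2) `^ 2^-1)); last first.
  apply/funext => t; case: (f t) => a b /=.
  by rewrite powR12_sqrt // addr_ge0 ?sqr_ge0.
apply: (@measurableT_comp _ _ _ _ _ _ (@powR R ^~ 2^-1)) => //.
by apply: measurable_funD; exact: measurable_funX.
Qed.

Lemma cmeasurable0 : cmeasurable (0 : T -> R[i]).
Proof. by split; exact: measurable_cst. Qed.

Lemma cmeasurableZD (a : R[i]) (f g : T -> R[i]) :
  cmeasurable f -> cmeasurable g -> cmeasurable (a *: f + g).
Proof.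
move=> [fr fi] [gr gi]; split.
- rewrite (_ : (fun t => _) = (fun t =>
    complex.Re a * complex.Re (f t) - complex.Im a * complex.Im (f t)
      + complex.Re (g t))); last first.
    apply/funext => t /=; rewrite !fctE/=.
    by case: a => a b; case: (f t) => ? ?; case: (g t).
  apply: measurable_funD => //; apply: measurable_funB;
    by apply: measurable_funM => //; exact: measurable_cst.
- rewrite (_ : (fun t => _) = (fun t =>
    complex.Re a * complex.Im (f t) + complex.Im a * complex.Re (f t)
      + complex.Im (g t))); last first.
    apply/funext => t /=; rewrite !fctE/=.
    by case: a => a b; case: (f t) => ? ?; case: (g t).
  apply: measurable_funD => //; apply: measurable_funD;
    by apply: measurable_funM => //; exact: measurable_cst.
Qed.

Lemma cLnorm_ge0 f : (0 <= cLnorm f)%E.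
Proof. exact: Lnorm_ge0. Qed.

Hypothesis p1 : (1 <= p)%E.

Let p0 : (0 < p)%E. Proof. exact: lt_le_trans p1. Qed.

Lemma le_cLnorm (u v : T -> R) :
  measurable_fun [set: T] u -> measurable_fun [set: T] v ->
  (forall t, 0 <= u t <= v t) ->
  ('N[mu]_p[EFin \o u] <= 'N[mu]_p[EFin \o v])%E.
Proof.
move=> mu' mv uv.
have u0 t : 0 <= u t by case/andP: (uv t).
have uv' t : u t <= v t by case/andP: (uv t).
have v0 t : 0 <= v t by exact: le_trans (uv' t).
rewrite unlock /Lnorm; case: p p1 => [r| |]//.
- rewrite lee_fin => r1; have r0 : 0 < r by exact: lt_le_trans r1.
  have int0 (w : T -> R) : (0 <= \int[mu]_x (`|(EFin \o w) x| `^ r))%E.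
    by apply: integral_ge0 => t _; exact: poweR_ge0.
  apply: gt0_ler_poweR; rewrite ?invr_ge0 ?(ltW r0) ?in_itv/= ?int0 ?leey//.
  apply: ge0_le_integral => //.
  + apply/measurable_EFinP.
    apply: (@measurableT_comp _ _ _ _ _ _ (@powR R ^~ r)) => //.
    exact: measurableT_comp.
  + apply/measurable_EFinP.
    apply: (@measurableT_comp _ _ _ _ _ _ (@powR R ^~ r)) => //.
    exact: measurableT_comp.
  + move=> t _ /=; rewrite lee_fin !ger0_norm//.
    by apply: ge0_ler_powR; rewrite ?nnegrE ?(ltW r0).
- move=> _; case: ifPn => // _; apply: le_ess_sup; apply/nearW => t /=.
  by rewrite lee_fin !ger0_norm.
Qed.

Lemma cLnormD (f g : T -> R[i]) : cmeasurable f -> cmeasurable g ->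
  (cLnorm (f + g)%R <= cLnorm f + cLnorm g)%E.
Proof.
move=> mf mg.
have mfg : cmeasurable (f + g) by rewrite -[f]scale1r; exact: cmeasurableZD.
pose nf t := Normc.normc (f t); pose ng t := Normc.normc (g t).
apply: (@le_trans _ _ ('N[mu]_p[EFin \o (nf \+ ng)%R])%E).
  apply: le_cLnorm; [exact: measurable_normc| |].
    by apply: measurable_funD; exact: measurable_normc.
  by move=> t; rewrite normc_ge0/=; exact: ler_normcD.
by apply: eminkowski => //; exact: measurable_normc.
Qed.

Lemma cLnormZ (a : R[i]) (f : T -> R[i]) : cmeasurable f ->
  (cLnorm f < +oo)%E -> cLnorm (a *: f) = ((Normc.normc a)%:E * cLnorm f)%E.
Proof.
move=> mf ffin; pose nf t := Normc.normc (f t).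
have nfL : (nf : T -> R) \in Lfun mu p.
  by apply/andP; rewrite !inE; split => //=; exact: measurable_normc.
have := @LnormZ _ _ _ mu p p1 (Lfun_Sub p1 nfL) (Normc.normc a).
rewrite ger0_norm ?normc_ge0// => <-.
by apply: eq_Lnorm => t /=; rewrite Normc.normcM.
Qed.

Lemma cLnorm0P (f : T -> R[i]) : cmeasurable f ->
  cLnorm f = 0%E <-> {ae mu, forall t, f t = 0}.
Proof.
move=> mf; split.
  move=> /Lnorm_eq0_eq0 => /(_ _ p0) H.
  have /H : measurable_fun [set: T] (fun t => (Normc.normc (f t))%:E).
    by apply/measurable_EFinP; exact: measurable_normc.
  by apply: filterS => t /(_ I) [] /Normc.eq0_normc.
move=> f0; rewrite /cLnorm -[RHS](@Lnorm0 _ _ _ mu p) ?gt_eqF//.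
rewrite unlock /Lnorm; case: p p1 => [r| |]// => [r1|_].
- congr (_ `^ _)%E; apply: ge0_ae_eq_integral => //.
  + apply/measurable_EFinP.
    apply: (@measurableT_comp _ _ _ _ _ _ (@powR R ^~ r)) => //.
    by apply: measurableT_comp => //; exact: measurable_normc.
  + by move=> x _; exact: poweR_ge0.
  + by move=> x _; exact: poweR_ge0.
  + by apply: filterS f0 => t /= -> _; rewrite Normc.normc0.
- case: ifPn => // _; apply: eq_ess_sup.
  by apply: filterS f0 => t /= ->; rewrite Normc.normc0.
Qed.

(* p1 is a phantom argument: the predicate is a submodule only for 1 <= p. *)
Definition cLfun_pred of (1 <= p)%E : {pred T -> R[i]} :=
  mem [set f | cmeasurable f /\ (cLnorm f < +oo)%E].

Lemma cLfunE f : f \in cLfun_pred p1 <-> cmeasurable f /\ (cLnorm f < +oo)%E.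
Proof. by split => [/set_mem//|H]; exact: mem_set. Qed.

Lemma cLfun_submod_closed : submod_closed (cLfun_pred p1).
Proof.
split.
  apply/cLfunE; split; first exact: cmeasurable0.
  rewrite (cLnorm0P cmeasurable0).2 ?ltry//.
  exact: nearW.
move=> a f g /cLfunE[mf ff] /cLfunE[mg gg]; apply/cLfunE.
split; first exact: cmeasurableZD.
apply: le_lt_trans (cLnormD _ mg) _.
  rewrite -[a *: f]addr0; exact: cmeasurableZD cmeasurable0.
rewrite lte_add_pinfty// cLnormZ// lte_mul_pinfty ?lee_fin ?normc_ge0//.
Qed.

HB.instance Definition _ :=
  GRing.isSubmodClosed.Build _ _ (cLfun_pred p1) cLfun_submod_closed.

Record cLfun := CLfun {
  cLfun_val :> T -> R[i];
  cLfun_valP : cLfun_val \in cLfun_pred p1 }.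

HB.instance Definition _ := [isSub for cLfun_val].
HB.instance Definition _ := [Choice of cLfun by <:].
HB.instance Definition _ := [SubChoice_isSubLmodule of cLfun by <:].

Definition cLnull : {pred cLfun} :=
  mem [set f : cLfun | {ae mu, forall t, f t = 0}].

Lemma cLnull_zmod_closed : zmod_closed cLnull.
Proof.
split; first by apply/mem_set; exact: nearW.
move=> f g /set_mem /= f0 /set_mem /= g0; apply/mem_set => /=.
by apply: filterS2 f0 g0 => t ft gt; rewrite !fctE ft gt subrr.
Qed.

HB.instance Definition _ := GRing.isZmodClosed.Build _ cLnull cLnull_zmod_closed.

(* cLnull is a submodule of cLfun, but ring_quotient only provides the additive
   group structure of the quotient. *)
Definition cLspace : Type := Quotient.quot cLnull.
HB.instance Definition _ := GRing.Zmodule.on cLspace.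
HB.instance Definition _ := EqQuotient.on cLspace.

Local Open Scope quotient_scope.

Definition cLclass (f : cLfun) : cLspace := \pi_(Quotient.quot cLnull) f.

Lemma cLclass_eq (f g : cLfun) :
  cLclass f = cLclass g <-> {ae mu, forall t, f t = g t}.
Proof.
have -> : (cLclass f = cLclass g) <-> f - g \in cLnull.
  by rewrite Quotient.idealrBE; split => /eqP.
rewrite /cLnull; split => [/set_mem/=|fg].
  by apply: filterS => t; rewrite !fctE => /subr0_eq.
by apply/mem_set; apply: filterS fg => t /= fg; rewrite !fctE fg subrr.
Qed.

Lemma cLclassK (x : cLspace) : cLclass (repr x) = x.
Proof. exact: reprK. Qed.

Lemma cLclassD (f g : cLfun) : cLclass (f + g) = cLclass f + cLclass g.
Proof. by rewrite /cLclass; exact: raddfD. Qed.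

Definition cLscale (a : R[i]) (x : cLspace) : cLspace := cLclass (a *: repr x).

Lemma repr_cLclass (f : cLfun) : {ae mu, forall t, repr (cLclass f) t = f t}.
Proof. by apply/cLclass_eq; rewrite cLclassK. Qed.

Lemma cLscaleE a f : cLscale a (cLclass f) = cLclass (a *: f).
Proof.
apply/cLclass_eq; apply: filterS (repr_cLclass f) => t /= ft.
by rewrite !fctE ft.
Qed.

Lemma cLscaleA a b x : cLscale a (cLscale b x) = cLscale (a * b) x.
Proof. by rewrite -(cLclassK x) !cLscaleE scalerA. Qed.

Lemma cLscale1 : left_id 1 cLscale.
Proof. by move=> x; rewrite -(cLclassK x) cLscaleE scale1r. Qed.

Lemma cLscaleDr : right_distributive cLscale +%R.
Proof.
move=> a x y; rewrite -(cLclassK x) -(cLclassK y).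
by rewrite -cLclassD !cLscaleE -cLclassD scalerDr.
Qed.

Lemma cLscaleDl x : {morph cLscale^~ x : a b / a + b}.
Proof.
by move=> a b /=; rewrite -(cLclassK x) !cLscaleE -cLclassD scalerDl.
Qed.

HB.instance Definition _ := GRing.Zmodule_isLmodule.Build R[i] cLspace
  cLscaleA cLscale1 cLscaleDr cLscaleDl.

(* The norm of a normed module over R[i] takes values in R[i]. *)
Definition cLspace_norm (x : cLspace) : R[i] := (fine (cLnorm (repr x)))%:C%C.

Lemma cLfunP (f : cLfun) : cmeasurable f /\ (cLnorm f < +oo)%E.
Proof. by apply/cLfunE; exact: cLfun_valP. Qed.

Lemma cLnorm_fin (f : cLfun) : cLnorm f \is a fin_num.
Proof. by rewrite ge0_fin_numE ?cLnorm_ge0//; case: (cLfunP f). Qed.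

Lemma ae_le_cLnorm (f g : cLfun) :
  {ae mu, forall t, f t = g t} -> (cLnorm f <= cLnorm g)%E.
Proof.
move=> fg; have [mf _] := cLfunP f; have [mg _] := cLfunP g.
have [mh _] := cLfunP (f - g).
rewrite [X in cLnorm X](_ : _ = ((f - g : cLfun) : T -> R[i]) + g); last first.
  by apply/funext => t; symmetry; exact: subrK.
apply: le_trans (cLnormD mh mg) _.
rewrite (cLnorm0P mh).2 ?add0e//.
by apply: filterS fg => t /= fg; rewrite !fctE fg subrr.
Qed.

Lemma cLspace_normE (f : cLfun) :
  cLspace_norm (cLclass f) = (fine (cLnorm f))%:C%C.
Proof.
congr (fine _)%:C%C; apply/eqP; rewrite eq_le; apply/andP; split.
  exact/ae_le_cLnorm/repr_cLclass.
by apply: ae_le_cLnorm; apply: filterS (repr_cLclass f) => t ->.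
Qed.

Lemma cLspace_normD x y :
  cLspace_norm (x + y) <= cLspace_norm x + cLspace_norm y.
Proof.
rewrite -(cLclassK x) -(cLclassK y) -cLclassD !cLspace_normE -rmorphD lecR.
rewrite -fineD ?cLnorm_fin// fine_le ?fin_numD ?cLnorm_fin//.
by apply: cLnormD; [case: (cLfunP (repr x))|case: (cLfunP (repr y))].
Qed.

Lemma cLspace_normZ a x : cLspace_norm (a *: x) = `|a| * cLspace_norm x.
Proof.
rewrite -(cLclassK x) [a *: _]cLscaleE !cLspace_normE.
have [mf ff] := cLfunP (repr x).
rewrite [cLnorm _](cLnormZ a mf ff) fineM ?cLnorm_fin//=.
by rewrite rmorphM.
Qed.

Lemma cLspace_norm0_eq0 x : cLspace_norm x = 0 -> x = 0.
Proof.
rewrite -(cLclassK x) cLspace_normE => -[] /eqP.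
rewrite fine_eq0 ?cLnorm_fin// => /eqP; have [mf _] := cLfunP (repr x).
move=> /(cLnorm0P mf) x0.
have -> : 0 = cLclass 0 by rewrite /cLclass raddf0.
by apply/cLclass_eq; apply: filterS x0 => t ->.
Qed.

HB.instance Definition _ := @Lmodule_isNormed.Build R[i] cLspace
  cLspace_norm cLspace_normD cLspace_normZ cLspace_norm0_eq0.

End ComplexLp.

(* Completeness of X plays no role in these definitions. *)
Section Polarization.
Context (R : realType) (X : normedModType R[i]).

Definition multilinear_form m (L : ('I_m -> X) -> R[i]) : Prop :=
  forall (x : 'I_m -> X) (j : 'I_m) (a : R[i]) (u v : X),
    L (dfwith x j (a *: u + v)) = a * L (dfwith x j u) + L (dfwith x j v).

Definition symmetric_form m (L : ('I_m -> X) -> R[i]) : Prop :=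
  forall (s : 'S_m) (x : 'I_m -> X), L (x \o s) = L x.

(* {ptws 'I_m -> X} is X^m with the product topology. *)
Definition continuous_form m (L : ('I_m -> X) -> R[i]) : Prop :=
  continuous (L : {ptws 'I_m -> X} -> R[i]^o).

Definition cont_sym_multilinear m (L : ('I_m -> X) -> R[i]) : Prop :=
  [/\ multilinear_form L, symmetric_form L & continuous_form L].

Definition hat m (L : ('I_m -> X) -> R[i]) (x : X) : R[i] := L (fun=> x).

Definition unit_ball : set X := [set x | `|x| <= 1].

Definition hat_norm m (L : ('I_m -> X) -> R[i]) : \bar R :=
  ereal_sup [set (Normc.normc (hat L x))%:E | x in unit_ball].

(* Each x i is repeated k i times, in consecutive coordinates; the list has
   length \sum_i k i, so the default value 0 of nth is never used. *)
Definition repeat_args n (k : 'I_n -> nat) (x : 'I_n -> X) :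
    'I_(\sum_i k i)%N -> X :=
  fun j => nth 0 (flatten [seq nseq (k i) (x i) | i <- enum 'I_n]) j.

Arguments repeat_args {n} k x _.

(* The infimum is taken in \bar R, so that it is +oo when no M is admissible. *)
Definition polarization_const n (k : 'I_n -> nat) : \bar R :=
  ereal_inf [set M%:E | M in [set M : R | 0 < M /\
    forall L : ('I_(\sum_i k i)%N -> X) -> R[i], cont_sym_multilinear L ->
      (ereal_sup [set (Normc.normc (L (repeat_args k x)))%:E
                 | x in [set x : 'I_n -> X | forall i, unit_ball (x i)]]
       <= M%:E * hat_norm L)%E]].

End Polarization.

(* 0 ^ 0 = 1 in nat, and fine p^-1 = 0 when p = +oo. *)
Definition polarization_bound (R : realType) n (k : 'I_n -> nat) (p : \bar R) : R :=
  let m := (\sum_i k i)%N in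
  ((m ^ m)%:R / (\prod_i k i ^ k i)%N%:R) `^ fine p^-1%E
    * ((\prod_i (k i)`!)%N%:R / (m`!)%:R).

(* Main.v *)
Require Import Defs.
From mathcomp Require Import all_boot all_order all_algebra.
From mathcomp Require Import perm complex cyclic separable cyclotomic.
From mathcomp Require Import all_classical all_reals all_analysis.
From mathcomp Require Import measurable_realfun ess_sup_inf.
From mathcomp Require Import ring lra.
Import Order.TTheory GRing.Theory Num.Theory.
Import numFieldNormedType.Exports.
Set Implicit Arguments.
Unset Strict Implicit.
Unset Printing Implicit Defensive.
Local Open Scope classical_set_scope.
Local Open Scope ring_scope.

(** Let m be the sum of the k_i.  Both upper bounds come from one randomized
    polarization argument, and sharpness from a monomial on l^p.

    Let z_1, ..., z_n be independent phases, each the product of a random sign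
    and a random (m+1)-th root of unity.  Expanding the m-linear form L on
    z_1 y_1 + ... + z_n y_n gives one term for each word in the letters
    1, ..., n; since E [z_i^a z_i^(-b)] = 0 for distinct a, b <= m, averaging
    against the inverse of prod_i z_i^(k_i) keeps only the words in which each
    letter i occurs k_i times.  By symmetry these m! / (k_1! ... k_n!) terms
    are equal, hence
      |L(y_1^(k_1) ... y_n^(k_n))|
        <= (k_1! ... k_n! / m!) ||hat L|| E ||sum_i z_i y_i||^m
    ([polarization_formula]).  For y_i = (k_i / m)^(1/s) x_i with x_i in the
    unit ball, sum_i ||y_i||^s <= 1, so the constant is at most the bound with
    exponent s whenever
      (A)  sum_i ||y_i||^s <= 1  implies  E ||sum_i z_i y_i||^m <= 1
    ([polarization_const_le_phases]).  When s = 1, (A) is the triangle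
    inequality, in any normed space.  Let now q be the conjugate exponent of s.
    Changing the sign of one phase preserves the law of the phases, so
    Clarkson's inequality
      (C)  ||x + y||^q + ||x - y||^q <= 2 (||x||^s + ||y||^s)^(q/s)
    yields E ||sum_i z_i y_i||^q <= (sum_i ||y_i||^s)^(q/s), by adding the
    vectors one at a time, and (A) follows for all m <= q because the means of
    order m are bounded by those of order q.

    For 2 <= q and s = q / (q - 1), (C) holds in L^q and in L^s.  For complex
    numbers it reduces by convexity to nonnegative reals, where it is a
    monotonicity statement in one variable ([clarkson_unit]); it is integrated
    with Minkowski's inequality in L^q and with a two-term Hoelder inequality
    in L^s.  The case 1 < p <= m' is then s = p, and the case m <= p < oo is
    q = p; for p = 1 and for p = oo the bound is that of s = 1, and for m = 1
    it is 1 whatever the exponent.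

    Conversely, on l^p the symmetric form with hat L (x) = prod_i x_i^(k_i)
    takes the value k_1! ... k_n! / m! at the unit vectors, while weighted
    AM-GM gives ||hat L|| <= (prod_i k_i^(k_i) / m^m)^(1/p); the quotient is
    the claimed bound ([polarization_bound_le_lp]). *)

(** * Words with prescribed letter counts *)

Definition word n (k : 'I_n -> nat) : seq 'I_n :=
  flatten [seq nseq (k i) i | i <- enum 'I_n].

Lemma size_word n (k : 'I_n -> nat) : size (word k) = (\sum_i k i)%N.
Proof.
rewrite /word size_flatten /shape -map_comp sumnE big_map big_enum /=.
by apply: eq_bigr => i _; rewrite size_nseq.
Qed.

Lemma count_word n (k : 'I_n -> nat) i : count_mem i (word k) = k i.
Proof.
rewrite /word count_flatten -map_comp sumnE big_map big_enum /=.
rewrite (bigD1 i)//= count_nseq /= eqxx mul1n big1 ?addn0// => j ji.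
by rewrite count_nseq /= (negbTE ji).
Qed.

Definition word_tuple n (k : 'I_n -> nat) : (\sum_i k i)%N.-tuple 'I_n :=
  tcast (size_word k) (in_tuple (word k)).

Lemma val_word_tuple n (k : 'I_n -> nat) : val (word_tuple k) = word k.
Proof. by rewrite /= val_tcast. Qed.

(** The rearrangements of s are obtained by choosing the first letter x and then
    rearranging s minus one x; both sides satisfy the resulting recursion,
    because the counts of the letters add up to the size of s. *)
Lemma size_permutations_fact n (s : seq 'I_n) :
  (size (permutations s) * \prod_i (count_mem i s)`! = (size s)`!)%N.
Proof.
have [m] := ubnP (size s); elim: m => // m IHm in s *; rewrite ltnS => sm.
have [->|s0] := eqVneq s [::].
  by rewrite big1 ?muln1.
have ssz : (0 < size s)%N by rewrite lt0n size_eq0.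
rewrite (perm_size (permutationsE ssz)) size_allpairs_dep.
rewrite sumnE big_map big_distrl /=.
have step x : x \in s ->
    (size (permutations (rem x s)) * \prod_i (count_mem i s)`! =
     count_mem x s * (size s).-1`!)%N.
  move=> xs.
  rewrite -(size_rem xs) -(IHm (rem x s)); last first.
    by rewrite size_rem// -ltnS prednK.
  rewrite mulnCA; congr (_ * _)%N; rewrite (bigD1 x)//= [RHS]mulnC.
  rewrite [in RHS](bigD1 x)//=.
  have cx : (0 < count_mem x s)%N by rewrite -has_count has_pred1.
  have -> : count_mem x (rem x s) = (count_mem x s).-1.
    by rewrite count_rem xs /= eqxx subn1.
  rewrite mulnAC -[in LHS](prednK cx) factS prednK// [RHS]mulnC.
  rewrite [RHS]mulnC (mulnC (_.-1)`!); congr (_ * _ * _)%N.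
  apply: eq_bigr => i ix; rewrite count_rem xs /=.
  by rewrite eq_sym (negbTE ix) subn0.
rewrite (@eq_big_seq _ _ _ _ _ _ (fun x => count_mem x s * (size s).-1`!)%N).
  rewrite -big_distrl /=.
  have -> : (\sum_(x <- undup s) count_mem x s = size s)%N.
    rewrite -sum1_size -[RHS]big_undup_iterop_count.
    by apply: eq_bigr => x _; rewrite Monoid.iteropE iter_addn_0 mul1n.
  by rewrite -{1}(prednK ssz) -factS prednK.
by move=> x; rewrite mem_undup; exact: step.
Qed.

(** The multinomial coefficient, kept as a number of words because the expansion
    of a form on a sum is indexed by words. *)
Definition multinomial n (k : 'I_n -> nat) : nat :=
  #|[pred t : (\sum_i k i)%N.-tuple 'I_n | perm_eq t (word k)]|.

Lemma multinomialE n (k : 'I_n -> nat) :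
  multinomial k = size (permutations (word k)).
Proof.
rewrite /multinomial cardE -(size_map val); apply/perm_size/uniq_perm.
- by rewrite map_inj_uniq ?enum_uniq//; exact: val_inj.
- exact: permutations_uniq.
move=> s; rewrite mem_permutations; apply/mapP/idP => [[t]|sw].
  by rewrite mem_enum inE => ? ->.
have ssz : size s == (\sum_i k i)%N by rewrite (perm_size sw) size_word.
by exists (Tuple ssz) => //; rewrite mem_enum inE.
Qed.

Lemma multinomial_fact n (k : 'I_n -> nat) :
  (multinomial k * \prod_i (k i)`! = (\sum_i k i)`!)%N.
Proof.
rewrite multinomialE -[in RHS]size_word -size_permutations_fact.
by congr (_ * _)%N; apply: eq_bigr => i _; rewrite count_word.
Qed.

(** * Symmetric multilinear forms *)

Section multilinear.
Context (R : realType) (X : normedModType R[i]) (m : nat).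
Variables (L : ('I_m -> X) -> R[i]) (Lm : multilinear_form L).

Lemma multilinear0 x j : L (dfwith x j 0) = 0.
Proof.
have := Lm x j 1 0 0; rewrite scale1r addr0 mul1r.
by move=> /eqP; rewrite eq_sym -subr_eq0 addrK => /eqP.
Qed.

Lemma multilinearD x j u v :
  L (dfwith x j (u + v)) = L (dfwith x j u) + L (dfwith x j v).
Proof. by rewrite -[u in LHS]scale1r Lm mul1r. Qed.

Lemma multilinearZ x j a u : L (dfwith x j (a *: u)) = a * L (dfwith x j u).
Proof. by rewrite -[a *: u]addr0 Lm multilinear0 addr0. Qed.

Lemma multilinear_sum1 (I : finType) x j (u : I -> X) :
  L (dfwith x j (\sum_i u i)) = \sum_i L (dfwith x j (u i)).
Proof.
apply: (big_morph (fun v => L (dfwith x j v))); last exact: multilinear0.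
by move=> ? ?; exact: multilinearD.
Qed.

Lemma dfwith_if (x : 'I_m -> X) j v :
  dfwith x j v = fun l => if l == j then v else x l.
Proof.
apply/funext => l; case: eqVneq => [->|lj]; first by rewrite dfwithin.
by rewrite dfwithout// eq_sym.
Qed.

Lemma multilinear_scale (c : 'I_m -> R[i]) (x : 'I_m -> X) :
  L (fun j => c j *: x j) = (\prod_j c j) * L x.
Proof.
suff H (s : seq 'I_m) : uniq s ->
    L (fun j => (if j \in s then c j else 1) *: x j)
    = (\prod_(j <- s) c j) * L x.
  have -> : \prod_j c j = \prod_(j <- enum 'I_m) c j by rewrite big_enum.
  rewrite -H ?enum_uniq//=.
  by congr L; apply/funext => j; rewrite mem_enum.
elim: s => [_|a s IH /= /andP[as_ us]].
  by rewrite big_nil mul1r; congr L; apply/funext => j; rewrite scale1r.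
rewrite big_cons -mulrA -IH//.
set y := (fun j => (if j \in s then _ else _) *: _).
have <- : dfwith y a (x a) = y.
  rewrite dfwith_if; apply/funext => j; case: eqVneq => // -> /=.
  by rewrite /y (negbTE as_) scale1r.
rewrite -multilinearZ; congr L; rewrite !dfwith_if /y; apply/funext => j.
by rewrite inE; case: eqVneq => [->//|] /=.
Qed.

(** The coordinates are expanded one at a time while the sum over all words t is
    kept: overwriting the letter of t at a position by an arbitrary letter,
    and summing over t and that letter, counts every word n times.  Expanding
    all m coordinates thus multiplies by n^m, which is then cancelled; no
    decomposition of words into initial and final parts is needed. *)
Lemma multilinear_sum (n : nat) (F : 'I_m -> 'I_n -> X) : (0 < n)%N ->
  L (fun j => \sum_i F j i)
  = \sum_(t : m.-tuple 'I_n) L (fun j => F j (tnth t j)).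
Proof.
move=> n0; pose upd (t : m.-tuple 'I_n) a i :=
  [tuple if j == a then i else tnth t j | j < m].
have updE t a i j : tnth (upd t a i) j = if j == a then i else tnth t j.
  by rewrite tnth_mktuple.
(* The pairs (t, i) are permuted by exchanging i with the letter of t at a. *)
have sum_upd (G : m.-tuple 'I_n -> R[i]) a :
    \sum_t \sum_i G (upd t a i) = n%:R * \sum_t G t.
  rewrite pair_big /=.
  pose h (ti : m.-tuple 'I_n * 'I_n) := (upd ti.1 a ti.2, tnth ti.1 a).
  have hK : cancel h h.
    move=> [t i]; rewrite /h /=; congr pair; last by rewrite updE eqxx.
    apply: eq_from_tnth => j; rewrite !updE.
    by case: eqVneq => [->|].
  rewrite (reindex_inj (can_inj hK)) /=.
  under eq_bigr => ti _ do rewrite -/(h ti) -[upd _ _ _]/((h (h ti)).1) hK.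
  rewrite -(pair_big xpredT xpredT (fun t _ => G t)) /= mulr_sumr.
  by apply: eq_bigr => t _; rewrite sumr_const card_ord mulr_natl.
pose A (s : seq 'I_m) t := fun j => if j \in s then \sum_i F j i else F j (tnth t j).
have H (s : seq 'I_m) : uniq s ->
    \sum_t L (A s t) = n%:R ^+ size s * \sum_t L (A [::] t).
  elim: s => [_|a s IH /= /andP[as_ us]]; first by rewrite expr0 mul1r.
  rewrite exprS -mulrA -IH// -(sum_upd _ a); apply: eq_bigr => t _.
  have -> : A (a :: s) t = dfwith (A s t) a (\sum_i F a i).
    rewrite dfwith_if; apply/funext => j; rewrite /A inE.
    by case: eqVneq => [->|].
  rewrite multilinear_sum1; apply: eq_bigr => i _; congr L.
  rewrite dfwith_if; apply/funext => j; rewrite /A updE.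
  by case: eqVneq => [->|//]; rewrite (negbTE as_).
have := H (enum 'I_m) (enum_uniq _).
have -> : \sum_t L (A (enum 'I_m) t) = n%:R ^+ m * L (fun j => \sum_i F j i).
  under eq_bigr => t _.
    have -> : A (enum 'I_m) t = fun j => \sum_i F j i; last over.
    by apply/funext => j; rewrite /A mem_enum.
  by rewrite sumr_const card_tuple card_ord -[LHS]mulr_natl natrX.
rewrite size_enum_ord; apply: mulfI.
by rewrite expf_neq0// pnatr_eq0 -lt0n.
Qed.

Lemma symmetric_perm (Ls : Defs.symmetric_form L) (n : nat) (y : 'I_n -> X)
    (t w : m.-tuple 'I_n) :
  perm_eq t w -> L (fun j => y (tnth t j)) = L (fun j => y (tnth w j)).
Proof.
move=> /tuple_permP[s ts].
rewrite -[RHS](Ls s); congr L; apply/funext => j /=; congr y.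
by rewrite [LHS](tnth_nth (tnth w j)) ts -tnth_nth tnth_mktuple.
Qed.
End multilinear.

Lemma repeat_argsE (R : realType) (X : normedModType R[i]) n (k : 'I_n -> nat)
    (x : 'I_n -> X) :
  @repeat_args R X n k x = fun j => x (tnth (word_tuple k) j).
Proof.
apply/funext => j; rewrite /repeat_args.
have -> : flatten [seq nseq (k i) (x i) | i <- enum 'I_n] = map x (word k).
  rewrite /word map_flatten -map_comp; congr flatten.
  by apply: eq_map => i /=; rewrite map_nseq.
rewrite (nth_map (tnth (word_tuple k) j)) ?size_word//.
by congr x; rewrite -val_word_tuple -tnth_nth.
Qed.

Lemma prod_seq_count (R : comNzRingType) n (s : seq 'I_n) (c : 'I_n -> R) :
  \prod_(i <- s) c i = \prod_i c i ^+ count_mem i s.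
Proof.
elim: s => [|x s IHs]; first by rewrite big_nil big1.
rewrite big_cons IHs /= (bigD1 x)//= [in RHS](bigD1 x)//= eqxx mulrA.
rewrite -exprS; congr (_ * _); apply: eq_bigr => i ix.
by rewrite eq_sym (negbTE ix).
Qed.

Lemma sum_seq_count (R : nmodType) n (s : seq 'I_n) (c : 'I_n -> R) :
  \sum_(i <- s) c i = \sum_i c i *+ count_mem i s.
Proof.
elim: s => [|x s IHs]; first by rewrite big_nil big1.
rewrite big_cons IHs /= (bigD1 x)//= [in RHS](bigD1 x)//= eqxx addrA.
rewrite -mulrS; congr (_ + _); apply: eq_bigr => i ix.
by rewrite eq_sym (negbTE ix).
Qed.

Lemma prod_tuple_count (R : comNzRingType) n m (t : m.-tuple 'I_n) (c : 'I_n -> R) :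
  \prod_j c (tnth t j) = \prod_i c i ^+ count_mem i t.
Proof. by rewrite -(big_tuple _ _ _ xpredT) prod_seq_count. Qed.

Lemma prod_word (R : comNzRingType) n (k : 'I_n -> nat) (c : 'I_n -> R) :
  \prod_j c (tnth (word_tuple k) j) = \prod_i c i ^+ k i.
Proof.
rewrite prod_tuple_count val_word_tuple.
by apply: eq_bigr => i _; rewrite count_word.
Qed.

(** * Random phases and the polarization formula *)

Lemma complex_prim_root (R : realType) N : (0 < N)%N ->
  exists w : R[i], N.-primitive_root w.
Proof.
move=> N0; have [r Dp] := closed_field_poly_normal ('X^N - 1 : {poly R[i]}).
rewrite (monicP _) ?monicXnsubC// scale1r in Dp.
have rN : all N.-unity_root r by apply/allP => z; rewrite -root_prod_XsubC -Dp.
have ur : uniq r.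
  by rewrite -separable_prod_XsubC -Dp separable_Xn_sub_1// pnatr_eq0 -lt0n.
have sr : (N <= size r)%N.
  by rewrite -ltnS -(size_prod_XsubC r id) -Dp size_XnsubC.
by have /hasP[w _ ?] := has_prim_root N0 rN ur sr; exists w.
Qed.

(** The sign is what later allows Clarkson's inequality to be used; the root of
    unity has order m + 1 so that powers up to m are pairwise orthogonal. *)
Definition phase (R : realType) m (w : R[i]) (a : bool * 'I_m.+1) : R[i] :=
  (-1) ^+ a.1 * w ^+ a.2.

Lemma phase_neq0 (R : realType) m (w : R[i]) (a : bool * 'I_m.+1) :
  m.+1.-primitive_root w -> phase w a != 0.
Proof.
move=> wP; rewrite /phase mulf_neq0 ?signr_eq0// expf_neq0//.
by rewrite (prim_root_eq0 wP).
Qed.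

Lemma normc_phase (R : realType) m (w : R[i]) (a : bool * 'I_m.+1) :
  m.+1.-primitive_root w -> `|phase w a| = 1.
Proof.
move=> wP; rewrite /phase normrM normr_sign mul1r normrX.
suff -> : `|w| = 1 by rewrite expr1n.
apply/eqP; rewrite -(@eqrXn2 _ m.+1)// ?ler01// expr1n -normrX.
by rewrite (prim_expr_order wP) normr1.
Qed.

Lemma phase_opp (R : realType) m (w : R[i]) (a : bool * 'I_m.+1) :
  phase w (~~ a.1, a.2) = - phase w a.
Proof. by rewrite /phase /= signrN mulNr. Qed.

Lemma sum_phase (R : realType) m (w : R[i]) (j k : nat) :
  m.+1.-primitive_root w -> (j <= m)%N -> (k <= m)%N ->
  \sum_(a : bool * 'I_m.+1) phase w a ^+ j * phase w a ^- k
  = (if j == k then #|{: bool * 'I_m.+1}|%:R else 0).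
Proof.
move=> wP jm km.
case: eqVneq => [->|jk].
  rewrite -sum1_card natr_sum; apply: eq_bigr => a _.
  by rewrite mulfV// expf_neq0// phase_neq0.
have wjk : w ^+ j / w ^+ k != 1.
  rewrite -subr_eq0; apply: contra jk => /eqP/subr0_eq/divr1_eq/eqP.
  by rewrite (eq_prim_root_expr wP) !modn_small.
rewrite -(pair_bigA _ (fun b a => phase w (b, a) ^+ j * phase w (b, a) ^- k)) /=.
apply: big1 => b _.
pose x := w ^+ j / w ^+ k; pose s : R[i] := ((-1) ^+ b) ^+ j / ((-1) ^+ b) ^+ k.
transitivity (\sum_(t < m.+1) s * x ^+ t).
  apply: eq_bigr => t _; rewrite /phase /= !exprMn invfM mulrACA.
  by rewrite exprVn (exprAC w j) (exprAC w k).
rewrite -mulr_sumr.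
have H : (w ^+ j / w ^+ k) ^+ m.+1 = 1.
  by rewrite exprMn exprVn (exprAC w j) (exprAC w k) (prim_expr_order wP) !expr1n divr1.
have := subrX1 (w ^+ j / w ^+ k) m.+1; rewrite H subrr => /esym/eqP.
by rewrite mulf_eq0 subr_eq0 (negbTE wjk) /= => /eqP ->; rewrite mulr0.
Qed.

(** Each word t contributes the product over i of the averages of
    z_i^(count of i in t) z_i^(- k_i), which vanishes unless t is a
    rearrangement of the word of k; by symmetry all rearrangements give the
    same value of L. *)
Lemma polarization_formula (R : realType) (X : normedModType R[i]) n (k : 'I_n -> nat)
    (L : ('I_(\sum_i k i)%N -> X) -> R[i]) (w : R[i]) (y : 'I_n -> X) :
  (0 < n)%N -> multilinear_form L -> Defs.symmetric_form L ->
  (\sum_i k i)%N.+1.-primitive_root w ->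
  \sum_(e : {ffun 'I_n -> bool * 'I_(\sum_i k i)%N.+1})
     (\prod_i phase w (e i) ^- k i) * hat L (\sum_i phase w (e i) *: y i)
  = (#|{ffun 'I_n -> bool * 'I_(\sum_i k i)%N.+1}|
      * multinomial k)%:R
    * L (@repeat_args R X n k y).
Proof.
move=> n0 Lm Ls wP; set I := (bool * _)%type.
pose c (e : {ffun 'I_n -> I}) i := phase w (e i).
have expand e : hat L (\sum_i c e i *: y i) =
    \sum_(t : (\sum_i k i)%N.-tuple 'I_n)
      (\prod_i c e i ^+ count_mem i t) * L (fun j => y (tnth t j)).
  rewrite /hat (multilinear_sum Lm (fun=> fun i => c e i *: y i))//.
  apply: eq_bigr => t _.
  rewrite (multilinear_scale Lm (fun j => c e (tnth t j))).
  by rewrite prod_tuple_count.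
transitivity (\sum_(e : {ffun 'I_n -> I}) \sum_(t : (\sum_i k i)%N.-tuple 'I_n)
    (\prod_i phase w (e i) ^- k i) *
      ((\prod_i c e i ^+ count_mem i t) * L (fun j => y (tnth t j)))).
  by apply: eq_bigr => e _; rewrite expand; exact: mulr_sumr.
rewrite exchange_big /=.
have ki i : (k i <= \sum_i k i)%N by rewrite (bigD1 i)//= leq_addr.
transitivity (\sum_(t : (\sum_i k i)%N.-tuple 'I_n | perm_eq t (word k))
    #|{ffun 'I_n -> I}|%:R * L (@repeat_args R X n k y)).
  rewrite [RHS]big_mkcond /=; apply: eq_bigr => t _.
  transitivity ((\prod_i \sum_(a : I) phase w a ^+ count_mem i t * phase w a ^- k i)
    * L (fun j => y (tnth t j))).
    rewrite bigA_distr_bigA mulr_suml; apply: eq_bigr => e _.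
    rewrite mulrA; congr (_ * _); rewrite mulrC.
    by symmetry; exact: big_split.
  have ct i : (count_mem i t <= \sum_i k i)%N.
    by rewrite -[X in (_ <= X)%N](size_tuple t) count_size.
  under eq_bigr => i _ do rewrite (sum_phase wP)//.
  case: ifPn => tw.
    rewrite repeat_argsE -(symmetric_perm Ls y (t := t)) ?val_word_tuple//.
    congr (_ * _); rewrite card_ffun natrX card_ord.
    under eq_bigr => i _ do rewrite (seq.permP tw) count_word eqxx.
    by rewrite prodr_const card_ord.
  have [i ki'] : exists i, count_mem i t != k i.
    apply/existsP; apply: contraR tw; rewrite negb_exists => /forallP H.
    apply/allP => i _ /=; rewrite count_word.
    by have := H i; rewrite negbK.
  by rewrite (bigD1 i)//= (negbTE ki') !mul0r.
rewrite big_const iter_addr_0 -[LHS]mulr_natl natrM -mulrA mulrCA.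
congr (_ * (_%:R * _)).
Qed.

(** * Upper bound in a space satisfying Clarkson's inequality *)

(** The norm of a normed module over R[i] has values in R[i]; this is its real
    value, to which real powers apply. *)
Definition rnorm (R : realType) (X : normedModType R[i]) (x : X) : R :=
  complex.Re `|x|.

Section rnorm.
Context (R : realType) (X : normedModType R[i]).
Implicit Types x y : X.

Lemma rnormE x : `|x| = (rnorm x)%:C%C.
Proof. by rewrite /rnorm RRe_real// ger0_real. Qed.

Lemma rnorm_ge0 x : 0 <= rnorm x.
Proof. by have := normr_ge0 x; rewrite rnormE lecR. Qed.

Lemma rnormD x y : rnorm (x + y) <= rnorm x + rnorm y.
Proof. by rewrite -lecR rmorphD/= -!rnormE ler_normD. Qed.

Lemma rnorm0 : rnorm (0 : X) = 0.
Proof. by rewrite /rnorm normr0. Qed.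

Lemma rnormZ (a : R[i]) x : rnorm (a *: x) = Normc.normc a * rnorm x.
Proof. by apply: complexI; rewrite -rnormE normrZ rnormE rmorphM. Qed.

Lemma rnorm_eq0 x : rnorm x = 0 -> x = 0.
Proof. by move=> x0; apply/eqP; rewrite -normr_eq0 rnormE x0. Qed.

Lemma rnorm_sum (I : Type) (r : seq I) (P : pred I) (f : I -> X) :
  rnorm (\sum_(i <- r | P i) f i) <= \sum_(i <- r | P i) rnorm (f i).
Proof.
elim/big_ind2: _ => // [|x1 x2 y1 y2 h1 h2]; first by rewrite rnorm0.
by apply: le_trans (rnormD _ _) _; exact: lerD.
Qed.

Lemma unit_ballP x : unit_ball x <-> rnorm x <= 1.
Proof. by rewrite /unit_ball /= rnormE -[1]/(1%:C%C) lecR. Qed.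

End rnorm.

Lemma normcE (R : realType) (z : R[i]) : `|z| = (Normc.normc z)%:C%C.
Proof. by []. Qed.

Lemma normc_eq (R : realType) (z : R[i]) (r : R) : `|z| = r%:C%C -> Normc.normc z = r.
Proof. by rewrite normcE => /complexI. Qed.

Lemma normc_prod (R : realType) (I : Type) (r : seq I) (P : pred I) (f : I -> R[i]) :
  Normc.normc (\prod_(i <- r | P i) f i) = \prod_(i <- r | P i) Normc.normc (f i).
Proof. by apply: normc_eq; rewrite normr_prod rmorph_prod. Qed.

Lemma normc_sum (R : realType) (I : Type) (r : seq I) (P : pred I) (f : I -> R[i]) :
  Normc.normc (\sum_(i <- r | P i) f i) <= \sum_(i <- r | P i) Normc.normc (f i).
Proof.
rewrite -lecR -normcE rmorph_sum; exact: ler_norm_sum.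
Qed.

Lemma normc_real (R : realType) (r : R) : 0 <= r -> Normc.normc (r%:C%C) = r.
Proof. by move=> r0; apply: normc_eq; rewrite ger0_norm// lecR. Qed.

Lemma normc_nat (R : realType) (n : nat) : Normc.normc (n%:R : R[i]) = n%:R.
Proof. by apply: normc_eq; rewrite normr_nat rmorph_nat. Qed.

Lemma powR_prod (R : realType) (I : Type) (r : seq I) (f : I -> R) (x : R) :
  (forall i, 0 <= f i) ->
  \prod_(i <- r) f i `^ x = (\prod_(i <- r) f i) `^ x.
Proof.
move=> f0; elim: r => [|i r IH]; first by rewrite !big_nil powR1.
by rewrite !big_cons IH powRM// prodr_ge0.
Qed.

Lemma powR_exprn (R : realType) (x r : R) (j : nat) : 0 <= x ->
  (x `^ r) ^+ j = (x ^+ j) `^ r.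
Proof.
by move=> x0; rewrite -(powR_mulrn _ (powR_ge0 x r)) -(powR_mulrn _ x0) powRAC.
Qed.

Lemma powRV (R : realType) (x y : R) : 0 <= x -> x^-1 `^ y = (x `^ y)^-1.
Proof.
by move=> x0; rewrite -[x^-1]powR_inv1// powRAC powR_inv1// powR_ge0.
Qed.

Lemma le_hat_norm (R : realType) (X : normedModType R[i]) m
    (L : ('I_m -> X) -> R[i]) (H : R) (z : X) :
  multilinear_form L -> (0 < m)%N -> (hat_norm L <= H%:E)%E ->
  Normc.normc (hat L z) <= H * rnorm z ^+ m.
Proof.
move=> Lm m0 LH.
have scale a u : hat L (a *: u) = a ^+ m * hat L u.
  by rewrite /hat (multilinear_scale Lm (fun=> a)) prodr_const card_ord.
have [z0|z0] := eqVneq (rnorm z) 0.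
  rewrite z0 (rnorm_eq0 z0) -(scale0r (0 : X)) scale.
  by rewrite !expr0n gtn_eqF// mul0r mulr0 Normc.normc0.
have zp : 0 < rnorm z by rewrite lt_neqAle eq_sym z0 rnorm_ge0.
have zp' : 0 <= (rnorm z)^-1 by rewrite invr_ge0 ltW.
pose u := ((rnorm z)^-1)%:C%C *: z.
have zu : z = (rnorm z)%:C%C *: u.
  by rewrite /u scalerA -rmorphM mulfV// scale1r.
have ub : unit_ball u.
  by apply/unit_ballP; rewrite /u rnormZ normc_real// mulVf.
have uH : Normc.normc (hat L u) <= H.
  by rewrite -lee_fin; apply: le_trans LH; apply: ereal_sup_ubound; exists u.
rewrite {1}zu scale Normc.normcM mulrC.
have -> : Normc.normc ((rnorm z)%:C%C ^+ m) = rnorm z ^+ m.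
  by apply: normc_eq; rewrite normrX ger0_norm ?lecR ?rnorm_ge0// rmorphXn.
by rewrite ler_wpM2r// exprn_ge0// rnorm_ge0.
Qed.

Lemma polarization_boundE (R : realType) n (k : 'I_n -> nat) (s : R) : s != 0 ->
  polarization_bound k s%:E =
  (((\sum_i k i)%N ^ (\sum_i k i)%N)%:R / (\prod_i k i ^ k i)%N%:R) `^ s^-1
    * ((\prod_i (k i)`!)%N%:R / ((\sum_i k i)%N`!)%:R).
Proof. by move=> s0; rewrite /polarization_bound inver (negbTE s0). Qed.

(** The expectation of the q-th power of the norm of sum_i z_i y_i, for
    independent uniform phases z_i. *)
Definition phase_average (R : realType) (X : normedModType R[i]) n m (w : R[i])
    (q : R) (y : 'I_n -> X) : R :=
  (\sum_(e : {ffun 'I_n -> bool * 'I_m.+1})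
     rnorm (\sum_i phase w (e i) *: y i) `^ q) / #|{ffun 'I_n -> bool * 'I_m.+1}|%:R.

Lemma card_phases n m : (0 < #|{ffun 'I_n -> bool * 'I_m.+1}|)%N.
Proof. by apply/card_gt0P; exists [ffun=> (false, ord0)]. Qed.

(** The weights (k_i / m)^(1/s) make the s-th powers of the norms sum to at most 1,
    and the product of their k_i-th powers is the (1/s)-th power of
    prod_i k_i^(k_i) / m^m, the inverse of the first factor of the bound. *)
Lemma polarization_const_le_phases (R : realType) (X : normedModType R[i]) n
    (k : 'I_n -> nat) (s : R) :
  (0 < \sum_i k i)%N -> 0 < s ->
  (forall (w : R[i]) (y : 'I_n -> X), (\sum_i k i)%N.+1.-primitive_root w ->
    \sum_i rnorm (y i) `^ s <= 1 ->
    phase_average (\sum_i k i)%N w (\sum_i k i)%N%:R y <= 1) ->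
  (polarization_const X k <= (polarization_bound k s%:E)%:E)%E.
Proof.
move=> m0 s0 avg; set m := (\sum_i k i)%N in m0 avg *.
have n0 : (0 < n)%N.
  by case: n k @m m0 avg => // k; rewrite big_ord0.
have kk : 0 < (\prod_i k i ^ k i)%N%:R :> R.
  by rewrite ltr0n prodn_gt0// => i; rewrite expn_gt0; case: (k i).
have kf : 0 < (\prod_i (k i)`!)%N%:R :> R.
  by rewrite ltr0n prodn_gt0// => i; exact: fact_gt0.
have mf : 0 < (m`!)%:R :> R by rewrite ltr0n fact_gt0.
have mm : 0 < (m ^ m)%:R :> R by rewrite ltr0n expn_gt0 m0.
have mR : 0 < m%:R :> R by rewrite ltr0n.
set B := polarization_bound k s%:E.
have B0 : 0 < B by rewrite mulr_gt0 ?powR_gt0 ?divr_gt0.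
apply: ereal_inf_lbound; exists B => //; split => // L [Lm Ls _].
apply: ge_ereal_sup => _ [x /= xb <-].
have hat0 : (0 <= hat_norm L)%E.
  apply: le_trans (_ : (Normc.normc (hat L 0))%:E <= _)%E.
    by rewrite lee_fin normc_ge0.
  apply: ereal_sup_ubound; exists 0 => //.
  by apply/unit_ballP; rewrite rnorm0.
case LHE : (hat_norm L) hat0 => [H| |] //; last first.
  by move=> _; rewrite gt0_muley ?leey// lte_fin.
rewrite lee_fin => H0; rewrite -EFinM lee_fin.
have LH : (hat_norm L <= H%:E)%E by rewrite LHE.
have [w wP] := complex_prim_root R (ltn0Sn m).
pose a i := ((k i)%:R / m%:R : R) `^ s^-1.
pose y i : X := (a i)%:C%C *: x i.
have a0 i : 0 <= a i by exact: powR_ge0.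
have ysum : \sum_i rnorm (y i) `^ s <= 1.
  apply: (@le_trans _ _ (\sum_i (k i)%:R / m%:R)).
    apply: ler_sum => i _; rewrite rnormZ normc_real// powRM ?rnorm_ge0//.
    rewrite /a -powRrM mulVf ?gt_eqF// powRr1; last by rewrite divr_ge0.
    rewrite ler_piMr ?divr_ge0//.
    have <- : 1 `^ s = 1 :> R by rewrite powR1.
    apply: ge0_ler_powR; rewrite ?nnegrE ?rnorm_ge0 ?(ltW s0)//.
    exact/unit_ballP.
  by rewrite -mulr_suml -natr_sum mulfV ?gt_eqF.
have := avg w y wP ysum; rewrite /phase_average.
rewrite ler_pdivrMr ?ltr0n ?card_phases// mul1r => avgle.
set C := multinomial k.
have polar : C%:R * Normc.normc (L (repeat_args y)) <= H.
  have N0 : 0 < #|{ffun 'I_n -> bool * 'I_m.+1}|%:R :> R by rewrite ltr0n card_phases.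
  rewrite -(ler_pM2l N0) mulrA -natrM -normc_nat -Normc.normcM.
  rewrite -(polarization_formula y n0 Lm Ls wP).
  apply: le_trans (normc_sum _ _ _) _.
  apply: (@le_trans _ _ (\sum_(e : {ffun 'I_n -> bool * 'I_m.+1})
     H * rnorm (\sum_i phase w (e i) *: y i) `^ m%:R)).
    apply: ler_sum => e _; rewrite Normc.normcM normc_prod big1; last first.
      move=> i _; apply: normc_eq; rewrite normfV normrX normc_phase//.
      by rewrite expr1n invr1.
    by rewrite mul1r powR_mulrn ?rnorm_ge0//; exact: le_hat_norm.
  by rewrite -mulr_sumr mulrC ler_wpM2r.
have repy : L (repeat_args y) = (\prod_i (a i)%:C%C ^+ k i) * L (repeat_args x).
  rewrite !repeat_argsE -prod_word.
  exact: (multilinear_scale Lm (fun j => (a (tnth (word_tuple k) j))%:C%C)).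
have prodE : \prod_i a i ^+ k i = ((\prod_i k i ^ k i)%N%:R / (m ^ m)%:R) `^ s^-1.
  rewrite (eq_bigr (fun i => ((k i ^ k i)%N%:R / (m%:R) ^+ k i) `^ s^-1)); last first.
    by move=> i _; rewrite powR_exprn ?divr_ge0// expr_div_n natrX.
  rewrite powR_prod; last by move=> i; rewrite divr_ge0// exprn_ge0.
  by rewrite prodf_div -natr_prod prodrXr natrX.
have mult : C%:R * (\prod_i (k i)`!)%N%:R = (m`!)%:R :> R.
  by rewrite -natrM multinomial_fact.
move: polar; rewrite repy Normc.normcM normc_prod.
rewrite (eq_bigr (fun i => a i ^+ k i)); last first.
  by move=> i _; apply: normc_eq; rewrite normrX ger0_norm ?lecR// rmorphXn.
rewrite prodE => polar.
set A := (_ / _) `^ _ in polar; have A0 : 0 < A by rewrite powR_gt0// divr_gt0.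
have C0 : 0 < C%:R :> R.
  rewrite lt_neqAle ler0n andbT; apply/eqP => C0.
  by move: mf; rewrite -mult -C0 mul0r ltxx.
have BE : B = (C%:R * A)^-1.
  rewrite /B polarization_boundE ?gt_eqF// -/m invfM mulrC; congr (_ * _).
    by rewrite -mult; field; rewrite !gt_eqF.
  by rewrite -[_ / _]invf_div powRV// divr_ge0 ?ltW.
by rewrite BE mulrC ler_pdivlMr ?mulr_gt0// mulrC -mulrA.
Qed.

Definition clarkson_space (R : realType) (X : normedModType R[i]) (s q : R) :=
  forall x y : X, rnorm (x + y) `^ q + rnorm (x - y) `^ q
    <= 2 * (rnorm x `^ s + rnorm y `^ s) `^ (q / s).

(** Minkowski's inequality in the r-th power mean, for the sum of f and a
    constant: f / T and 1 are averaged with weights T / (T + c) and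
    c / (T + c), and x^r is convex. *)
Lemma sum_powR_shift (R : realType) (I : finType) (f : I -> R) (T c r : R) :
  1 <= r -> (forall i, 0 <= f i) -> 0 <= T -> 0 <= c ->
  \sum_i f i `^ r <= #|I|%:R * T `^ r ->
  \sum_i (f i + c) `^ r <= #|I|%:R * (T + c) `^ r.
Proof.
move=> r1 f0 T0 c0 fT; have r0 : 0 < r by exact: lt_le_trans r1.
have [T00|Tneq0] := eqVneq T 0.
  have fE i : f i = 0.
    apply: (@powR_eq0_eq0 _ _ r); apply/eqP; rewrite eq_le powR_ge0 andbT.
    move: fT; rewrite T00 powR0 ?gt_eqF// mulr0; apply: le_trans.
    by rewrite (bigD1 i)//= lerDl sumr_ge0// => j _; exact: powR_ge0.
  rewrite T00; under eq_bigr => i _ do rewrite fE.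
  by rewrite sumr_const mulr_natl.
have T1 : 0 < T by rewrite lt_neqAle eq_sym Tneq0.
have Tc : 0 < T + c by lra.
pose t := T / (T + c).
have t0 : 0 <= t by rewrite divr_ge0 ?ltW.
have t1 : t <= 1 by rewrite ler_pdivrMr// mul1r; lra.
have le1 i : (f i + c) `^ r <= (T + c) `^ r * (t * (f i `^ r / T `^ r) + (1 - t)).
  have -> : f i + c = (T + c) * (t * (f i / T) + (1 - t) * 1).
    by rewrite /t; field; rewrite !gt_eqF.
  have h0 : 0 <= f i / T by rewrite divr_ge0.
  rewrite powRM ?(ltW Tc)//; last first.
    by rewrite addr_ge0// mulr_ge0// subr_ge0.
  rewrite ler_pM2l ?powR_gt0//.
  have := convex_powR r1 (Itv01 t0 t1) (x := f i / T) (y := 1).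
  rewrite !inE/= !in_itv/= h0 ler01 => /(_ isT isT).
  rewrite convRE [X in X `^ _ <= _]convRE/=.
  have -> : (f i / T) `^ r = f i `^ r / T `^ r.
    by rewrite powRM ?invr_ge0// powRV.
  by rewrite powR1 !mulr1.
apply: le_trans (ler_sum _ (fun i _ => le1 i)) _.
rewrite -mulr_sumr mulrC ler_wpM2r ?powR_ge0// big_split/= -mulr_sumr -mulr_suml.
rewrite sumr_const -[(1 - t) *+ _]mulr_natr.
have Tr : 0 < T `^ r by exact: powR_gt0.
have : (\sum_i f i `^ r) / T `^ r <= #|I|%:R by rewrite ler_pdivrMr.
by move=> /(ler_wpM2l t0); lra.
Qed.

(** Induction on the set of vectors added.  The sum S over a list without a does
    not involve the phase of a, so replacing that phase by its opposite shows
    that S + z_a y_a may be replaced by the half sum over S + z_a y_a and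
    S - z_a y_a, which Clarkson's inequality controls. *)
Lemma phase_average_le (R : realType) (X : normedModType R[i]) n m (s q : R)
    (w : R[i]) (y : 'I_n -> X) :
  m.+1.-primitive_root w -> 0 < s -> s <= q -> clarkson_space X s q ->
  phase_average m w q y <= (\sum_i rnorm (y i) `^ s) `^ (q / s).
Proof.
move=> wP s0 sq cX.
have q0 : 0 < q by exact: lt_le_trans sq.
have r1 : 1 <= q / s by rewrite ler_pdivlMr// mul1r.
rewrite /phase_average ler_pdivrMr ?ltr0n ?card_phases//.
set Omega := ({ffun 'I_n -> bool * 'I_m.+1} : finType).
pose S (r : seq 'I_n) (e : Omega) := \sum_(i <- r) phase w (e i) *: y i.
suff H (r : seq 'I_n) : uniq r ->
    \sum_e rnorm (S r e) `^ q <=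
    #|{: Omega}|%:R * (\sum_(i <- r) rnorm (y i) `^ s) `^ (q / s).
  have := H (enum 'I_n) (enum_uniq _).
  rewrite [in X in _ <= X]big_enum /= mulrC; apply: le_trans.
  by apply: ler_sum => e _; rewrite /S big_enum.
elim: r => [_|a r IH /= /andP[ar /IH{}IH]].
  rewrite big_nil powR0 ?mulr0; last by rewrite gt_eqF// divr_gt0.
  by rewrite big1// => e _; rewrite /S big_nil rnorm0 powR0// gt_eqF.
pose flip (e : Omega) : Omega :=
  [ffun i => if i == a then (~~ (e i).1, (e i).2) else e i].
have flipK : cancel flip flip.
  move=> e; apply/ffunP => i; rewrite !ffunE; case: eqVneq => //= _.
  by rewrite negbK -surjective_pairing.
have S_flip e : S r (flip e) = S r e.
  apply: eq_big_seq => i ir; rewrite ffunE; case: eqVneq => // ia.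
  by rewrite -ia ir in ar.
have sumE : \sum_e rnorm (S (a :: r) e) `^ q =
    \sum_e (rnorm (S r e + phase w (e a) *: y a) `^ q
            + rnorm (S r e - phase w (e a) *: y a) `^ q) / 2.
  rewrite -mulr_suml big_split /= [X in _ + X](reindex_inj (can_inj flipK)) /=.
  rewrite [X in _ + X](eq_bigr (fun e => rnorm (S r e + phase w (e a) *: y a) `^ q)).
    (* Both halves are now the same sum, by the change of variables flip. *)
    have half (z : R) : (z + z) / 2 = z by field.
    rewrite half; by apply: eq_bigr => e _; rewrite /S big_cons addrC.
  by move=> e _; rewrite S_flip ffunE eqxx phase_opp scaleNr opprK.
rewrite sumE big_cons addrC.
have norm1 (e : Omega) : rnorm (phase w (e a) *: y a) = rnorm (y a).
  by rewrite rnormZ (normc_eq (r := 1)) ?mul1r// normc_phase.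
apply: (@le_trans _ _ (\sum_e (rnorm (S r e) `^ s + rnorm (y a) `^ s) `^ (q / s))).
  apply: ler_sum => e _; rewrite ler_pdivrMr// mulrC.
  by apply: le_trans (cX _ _) _; rewrite norm1.
apply: sum_powR_shift => //; try by move=> *; exact: powR_ge0.
  by apply: sumr_ge0 => i _; exact: powR_ge0.
apply: le_trans IH; apply: ler_sum => e _.
by rewrite -powRrM mulrC divfK// gt_eqF.
Qed.

(** Monotonicity of power means, from Young's inequality
    z^a <= (a/q) z^q + (1 - a/q). *)
Lemma phase_average_mono (R : realType) (X : normedModType R[i]) n m (a q : R)
    (w : R[i]) (y : 'I_n -> X) :
  0 < a -> a <= q -> phase_average m w q y <= 1 -> phase_average m w a y <= 1.
Proof.
move=> a0; rewrite le_eqVlt => /predU1P[->//|aq].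
have q0 : 0 < q by exact: lt_trans aq.
rewrite /phase_average; set N := #|_|.
have N0 : 0 < N%:R :> R by rewrite ltr0n card_phases.
rewrite !ler_pdivrMr// !mul1r => le1.
pose t := a / q.
have t0 : 0 <= t by rewrite divr_ge0 ?ltW.
have t1 : t < 1 by rewrite ltr_pdivrMr// mul1r.
have young (z : R) : 0 <= z -> z `^ a <= t * z `^ q + (1 - t).
  move=> z0.
  have p0 : 0 < q / a by rewrite divr_gt0.
  have r0 : 0 < (1 - t)^-1 by rewrite invr_gt0 subr_gt0.
  have pr : (q / a)^-1 + (1 - t)^-1^-1 = 1 by rewrite invrK invf_div subrKC.
  have := conjugate_powR (powR_ge0 z a) ler01 p0 r0 pr.
  rewrite invrK powR1 mulr1 mul1r -powRrM invf_div.
  have -> : a * (q / a) = q by field; rewrite gt_eqF.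
  by rewrite [_ * (a / q)]mulrC.
apply: le_trans (ler_sum _ (fun e _ => young _ (rnorm_ge0 _))) _.
rewrite big_split/= -mulr_sumr sumr_const -[(1 - t) *+ _]mulr_natr -/N.
by have := ler_wpM2l t0 le1; lra.
Qed.

Lemma polarization_const_le_clarkson (R : realType) (X : normedModType R[i]) n
    (k : 'I_n -> nat) (s q : R) :
  (0 < \sum_i k i)%N -> 0 < s -> s <= q -> (\sum_i k i)%N%:R <= q ->
  clarkson_space X s q ->
  (polarization_const X k <= (polarization_bound k s%:E)%:E)%E.
Proof.
move=> m0 s0 sq mq cX; apply: polarization_const_le_phases => // w y wP y1.
apply: (phase_average_mono _ mq); first by rewrite ltr0n.
apply: le_trans (phase_average_le y wP s0 sq cX) _.
have <- : 1 `^ (q / s) = 1 :> R by rewrite powR1.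
have ? : 0 <= \sum_i rnorm (y i) `^ s.
  by apply: sumr_ge0 => i _; exact: powR_ge0.
by apply: ge0_ler_powR; rewrite ?nnegrE// divr_ge0 ?ltW// (lt_le_trans s0).
Qed.

Lemma polarization_const_le_trivial (R : realType) (X : normedModType R[i]) n
    (k : 'I_n -> nat) : (0 < \sum_i k i)%N ->
  (polarization_const X k <= (polarization_bound k 1%:E)%:E)%E.
Proof.
move=> m0; apply: polarization_const_le_phases => // w y wP y1.
rewrite /phase_average ler_pdivrMr ?ltr0n ?card_phases// mul1r.
have le1 (e : {ffun 'I_n -> bool * 'I_(\sum_i k i)%N.+1}) :
    rnorm (\sum_i phase w (e i) *: y i) `^ (\sum_i k i)%N%:R <= 1.
  rewrite powR_mulrn ?rnorm_ge0// exprn_ile1 ?rnorm_ge0//.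
  apply: le_trans (rnorm_sum _ _ _) _; apply: le_trans y1; apply: ler_sum => i _.
  by rewrite powRr1 ?rnorm_ge0// rnormZ (normc_eq (r := 1)) ?mul1r// normc_phase.
by apply: le_trans (ler_sum _ (fun e _ => le1 e)) _; rewrite sumr_const.
Qed.

(** * Clarkson's inequality for scalars *)

Lemma powR_pred (R : realType) (x r s : R) : 0 < x -> r = 1 + s ->
  x `^ r = x * x `^ s.
Proof.
by move=> x0 ->; rewrite powRD ?(gt_eqF x0) ?implybT// powRr1// ltW.
Qed.

(** With F(c) = (1 + c^(1-q) x) (1 + c x)^(q-1) + (1 - c^(1-q) x) (1 - c x)^(q-1),
    the left-hand side is F(1), and the right-hand side is F(a) for the a in
    ]0, 1] with a^(q-1) = x, for which the second term vanishes.  The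
    derivative of F is
      (q - 1) x (1 - c^(-q)) ((1 + c x)^(q-2) - (1 - c x)^(q-2)),
    which is nonpositive on [a, 1]. *)
Lemma clarkson_unit (R : realType) (q x : R) : 2 <= q -> 0 < x < 1 ->
  (1 + x) `^ q + (1 - x) `^ q <= 2 * (1 + x `^ (q / (q - 1))) `^ (q - 1).
Proof.
move=> q2 /andP[x0 x1].
pose F := fun c : R => (1 + c `^ (1 - q) * x) * (1 + c * x) `^ (q - 1)
                 + (1 - c `^ (1 - q) * x) * (1 - c * x) `^ (q - 1).
pose a := x `^ (q - 1)^-1.
have a0 : 0 < a by exact: powR_gt0.
have a1 : a <= 1.
  have <- : 1 `^ (q - 1)^-1 = 1 :> R by rewrite powR1.
  by apply: ge0_ler_powR; rewrite ?nnegrE ?invr_ge0; lra.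
have pos c : a <= c <= 1 -> [/\ 0 < c, 0 < 1 + c * x & 0 < 1 - c * x].
  by move=> /andP[ac c1]; split; nra.
have dF c : a <= c <= 1 -> is_derive c 1 F
    ((q - 1) * x * (1 - c `^ (- q)) * ((1 + c * x) `^ (q - 2) - (1 - c * x) `^ (q - 2))).
  move=> /pos[c0 p1 p2].
  pose u := fun c : R => 1 + c * x; pose v := fun c : R => 1 - c * x.
  have dx : is_derive c 1 (id * cst x : R -> R) x.
    apply: (is_derive_eq (is_deriveM (is_derive_id c 1) (is_derive_cst x c 1))).
    by rewrite /GRing.scale /= mulr0 add0r mulr1.
  have du : is_derive c 1 u x.
    have := is_deriveD (is_derive_cst (1 : R) c 1) dx; rewrite add0r; exact.
  have dv : is_derive c 1 v (- x).
    have := is_deriveB (is_derive_cst (1 : R) c 1) dx; rewrite add0r; exact.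
  have dK : is_derive c 1 (fun c : R => c `^ (1 - q) * x) ((1 - q) * c `^ (- q) * x).
    have H := is_derive1_powR (1 - q) c0.
    apply: (is_derive_eq (is_deriveM H (is_derive_cst x c 1))).
    rewrite /GRing.scale /= mulr0 add0r mulrC.
    by rewrite (_ : 1 - q - 1 = - q)//; ring.
  have dA : is_derive c 1 (fun c : R => u c `^ (q - 1)) ((q - 1) * u c `^ (q - 2) * x).
    have H := is_derive1_powR (q - 1) p1.
    have := @is_derive1_comp _ (fun y => y `^ (q - 1)) u c _ _ H du.
    by rewrite /= (_ : q - 1 - 1 = q - 2)//; ring.
  have dB : is_derive c 1 (fun c : R => v c `^ (q - 1)) ((q - 1) * v c `^ (q - 2) * - x).
    have H := is_derive1_powR (q - 1) p2.
    have := @is_derive1_comp _ (fun y => y `^ (q - 1)) v c _ _ H dv.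
    by rewrite /= (_ : q - 1 - 1 = q - 2)//; ring.
  have dK1 := is_deriveD (is_derive_cst (1 : R) c 1) dK.
  have dK2 := is_deriveB (is_derive_cst (1 : R) c 1) dK.
  have := is_deriveD (is_deriveM dK1 dA) (is_deriveM dK2 dB).
  move=> /is_derive_eq; apply.
  rewrite !fctE /GRing.scale /= !add0r.
  have -> : c `^ (1 - q) = c * c `^ (- q) by exact: powR_pred.
  have uE : u c `^ (q - 1) = u c * u c `^ (q - 2).
    by apply: powR_pred => //; ring.
  have vE : v c `^ (q - 1) = v c * v c `^ (q - 2).
    by apply: powR_pred => //; ring.
  by rewrite uE vE /u /v; ring.
have cF : {within `[a, 1], continuous F}.
  apply: derivable_within_continuous => c; rewrite in_itv /= => /dF dc.
  exact: ex_derive.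
have Fle : F 1 <= F a.
  apply: (@ler0_derive1_le_cc _ F a 1) => //; rewrite ?in_itv/= ?lexx ?a1//.
    move=> c; rewrite in_itv /= => /andP[/ltW ac /ltW c1].
    by apply: ex_derive; apply: dF; rewrite ac.
  move=> c; rewrite in_itv /= => /andP[/ltW ac /ltW c1].
  have aci : a <= c <= 1 by rewrite ac.
  have [c0 p1 p2] := pos _ aci.
  rewrite derive1E; have [_ ->] := dF _ aci.
  apply: mulr_le0_ge0; last first.
    by rewrite subr_ge0; apply: ge0_ler_powR; rewrite ?nnegrE; nra.
  apply: mulr_ge0_le0; first nra.
  rewrite subr_le0 powRN -[leLHS]invr1 lef_pV2 ?posrE ?powR_gt0//.
  have <- : 1 `^ q = 1 :> R by rewrite powR1.
  by apply: ge0_ler_powR; rewrite ?nnegrE; nra.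
have F1 : F 1 = (1 + x) `^ q + (1 - x) `^ q.
  by rewrite /F powR1 !mul1r; congr (_ + _); rewrite mulr_powRB1//; lra.
have Fa : F a = 2 * (1 + x `^ (q / (q - 1))) `^ (q - 1).
  rewrite /F.
  have -> : a `^ (1 - q) = x^-1.
    rewrite -powRrM (_ : _ * _ = -1) ?powR_inv1 ?(ltW x0)//; field.
    by apply/eqP; lra.
  rewrite mulVf ?gt_eqF// subrr mul0r addr0 -[1 + 1]/(2%:R).
  congr (_ * (1 + _) `^ _).
  rewrite mulrC; symmetry; apply: powR_pred => //; field.
  by apply/eqP; lra.
by rewrite -F1 -Fa.
Qed.

Lemma clarkson_real (R : realType) (q a b : R) : 2 <= q -> 0 <= a -> 0 <= b ->
  (a + b) `^ q + `|a - b| `^ q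
    <= 2 * (a `^ (q / (q - 1)) + b `^ (q / (q - 1))) `^ (q - 1).
Proof.
move=> q2; wlog ba : a b / b <= a => [wlg a0 b0|a0 b0].
  have [/wlg|/ltW/wlg] := leP b a; first exact.
  by rewrite (addrC b) distrC (addrC (b `^ _)); exact.
rewrite ger0_norm ?subr_ge0//.
have [b00|b_neq0] := eqVneq b 0.
  have h : q / (q - 1) != 0 by rewrite mulf_neq0 ?invr_eq0//; apply/eqP; lra.
  rewrite b00 powR0// addr0 subr0 addr0 -powRrM divfK; first lra.
  by apply/eqP; lra.
have b1 : 0 < b by rewrite lt_neqAle eq_sym b_neq0.
have a1 : 0 < a by exact: lt_le_trans ba.
have E : a `^ (q / (q - 1)) `^ (q - 1) = a `^ q.
  by rewrite -powRrM divfK//; apply/eqP; lra.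
have [->|ab] := eqVneq b a.
  rewrite subrr powR0 ?addr0; last by apply/eqP; lra.
  rewrite -[X in (X + X) `^ q]mul1r -[X in (X + X) `^ (q - 1)]mul1r -!mulrDl.
  rewrite !powRM ?powR_ge0 ?(ltW a1)// E mulrA -[1 + 1]/(2%:R).
  have -> : 2 * 2 `^ (q - 1) = 2 `^ q :> R by rewrite mulr_powRB1//; lra.
  exact: lexx.
have x01 : 0 < b / a < 1.
  by rewrite divr_gt0//= ltr_pdivrMr// mul1r lt_neqAle ab.
have := clarkson_unit q2 x01.
have -> : a + b = a * (1 + b / a) by field; rewrite gt_eqF.
have -> : a - b = a * (1 - b / a) by field; rewrite gt_eqF.
have -> : b `^ (q / (q - 1)) = a `^ (q / (q - 1)) * (b / a) `^ (q / (q - 1)).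
  rewrite -powRM ?(ltW a1) ?divr_ge0//; first by congr (_ `^ _); field; rewrite gt_eqF.
move: x01; set x := b / a => /andP[x0 x1].
set A := a `^ _.
have -> : A + A * x `^ (q / (q - 1)) = A * (1 + x `^ (q / (q - 1))) by ring.
have y0 := powR_ge0 x (q / (q - 1)).
rewrite (powRM _ a0); last lra. 
rewrite (powRM _ a0); last lra.
rewrite (powRM _ (powR_ge0 _ _)); last lra.
by rewrite {}/A E -mulrDr mulrCA ler_pM2l ?powR_gt0.
Qed.


(** A + B and A - B are convex combinations of A + D and A - D with exchanged
    weights. *)
Lemma convex_spread (R : realType) (r A B D : R) :
  1 <= r -> `|B| <= D -> D <= A ->
  (A + B) `^ r + (A - B) `^ r <= (A + D) `^ r + (A - D) `^ r.
Proof.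
move=> r1 BD DA; have D0 : 0 <= D by exact: le_trans (normr_ge0 _) BD.
move: BD; rewrite ler_norml => /andP[DB BD].
have [D00|Dneq0] := eqVneq D 0.
  have -> : B = 0 by lra.
  by rewrite D00.
have D1 : 0 < D by rewrite lt_neqAle eq_sym Dneq0.
have conv t : 0 <= t -> t <= 1 ->
    (t * (A + D) + (1 - t) * (A - D)) `^ r <= t * (A + D) `^ r + (1 - t) * (A - D) `^ r.
  move=> t0 t1.
  by apply: (convex_powR r1 (Itv01 t0 t1)); rewrite ?inE/= ?in_itv/=; lra.
pose t := (D + B) / (2 * D).
have t0 : 0 <= t by rewrite divr_ge0; lra.
have t1 : t <= 1 by rewrite ler_pdivrMr; lra.
have c1 := conv _ t0 t1.
have u0 : 0 <= 1 - t by lra.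
have u1 : 1 - t <= 1 by lra.
have c2 := conv _ u0 u1.
have e1 : t * (A + D) + (1 - t) * (A - D) = A + B by rewrite /t; field.
have e2 : (1 - t) * (A + D) + (1 - (1 - t)) * (A - D) = A - B by rewrite /t; field.
rewrite e1 in c1; rewrite e2 in c2.
have := lerD c1 c2; lra.
Qed.

(** The squared moduli of a + b and a - b are A + B and A - B with
    A = |a|^2 + |b|^2 and |B| <= 2 |a| |b|; by convexity of x^(q/2) the worst
    case is that of the nonnegative reals |a| and |b|. *)
Lemma clarkson_complex (R : realType) (q : R) (a b : R[i]) : 2 <= q ->
  Normc.normc (a + b) `^ q + Normc.normc (a - b) `^ q
  <= 2 * (Normc.normc a `^ (q / (q - 1)) + Normc.normc b `^ (q / (q - 1))) `^ (q - 1).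
Proof.
move=> q2; apply: le_trans (clarkson_real q2 (normc_ge0 a) (normc_ge0 b)).
have sq (y : R) : 0 <= y -> y `^ q = (y ^+ 2) `^ (q / 2).
  by move=> y0; rewrite -powR_mulrn// -powRrM; congr (_ `^ _); field.
have nn (z : R[i]) : Normc.normc z ^+ 2 = complex.Re z ^+ 2 + complex.Im z ^+ 2.
  by case: z => x y /=; rewrite sqr_sqrtr// addr_ge0 ?sqr_ge0.
pose B := 2 * (complex.Re a * complex.Re b + complex.Im a * complex.Im b).
rewrite !sq ?normc_ge0// ?addr_ge0 ?normc_ge0//.
have -> : `|Normc.normc a - Normc.normc b| ^+ 2 =
    (Normc.normc a ^+ 2 + Normc.normc b ^+ 2) - 2 * (Normc.normc a * Normc.normc b).
  by rewrite real_normK ?num_real//; ring.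
have -> : (Normc.normc a + Normc.normc b) ^+ 2 =
    (Normc.normc a ^+ 2 + Normc.normc b ^+ 2) + 2 * (Normc.normc a * Normc.normc b).
  by ring.
have -> : Normc.normc (a + b) ^+ 2 = (Normc.normc a ^+ 2 + Normc.normc b ^+ 2) + B.
  by rewrite !nn /B; clear B sq q2; move: a b => [? ?] [? ?] /=; ring.
have -> : Normc.normc (a - b) ^+ 2 = (Normc.normc a ^+ 2 + Normc.normc b ^+ 2) - B.
  by rewrite !nn /B; clear B sq q2; move: a b => [? ?] [? ?] /=; ring.
apply: convex_spread; first lra.
  rewrite /B normrM ger0_norm// ler_pM2l//.
  rewrite -(@ler_pXn2r _ 2)// ?nnegrE ?mulr_ge0 ?normc_ge0//.
  rewrite real_normK ?num_real// exprMn !nn.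
  have := sqr_ge0 (complex.Re a * complex.Im b - complex.Im a * complex.Re b); lra.
have := sqr_ge0 (Normc.normc a - Normc.normc b); lra.
Qed.

(** * Clarkson's inequalities in the complex L^p spaces *)

Lemma conjugate_exponent (R : realType) (q : R) : 2 <= q ->
  [/\ 0 < q, 0 < q / (q - 1), q / (q / (q - 1)) = q - 1 & 1 <= q - 1].
Proof.
move=> q2; have ? : 0 < q by lra. have ? : 0 < q - 1 by lra.
split => //; last lra; first by rewrite divr_gt0.
by field; rewrite !gt_eqF.
Qed.

Lemma conjugate_exponent_le (R : realType) (q : R) : 2 <= q -> q / (q - 1) <= q.
Proof.
move=> q2; have ? : 0 < q - 1 by lra.
by rewrite ler_pdivrMr//; nra.
Qed.

(** The choice al = U^(r-1), be = V^(r-1) turns the two sides of the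
    hypothesis into D = U^r + V^r and D^(1/r') 2^(1/r) P. *)
Lemma two_term_duality (R : realType) (r U V P : R) (r' := r / (r - 1)) :
  1 < r -> 0 <= U -> 0 <= V -> 0 <= P ->
  (forall al be, 0 <= al -> 0 <= be ->
    al * U + be * V <= (al `^ r' + be `^ r') `^ r'^-1 * (2 `^ r^-1 * P)) ->
  U `^ r + V `^ r <= 2 * P `^ r.
Proof.
move=> r1 U0 V0 P0 integrated.
have r0 : 0 < r by lra.
have r10 : 0 < r - 1 by lra.
have rr : r'^-1 + r^-1 = 1 by rewrite /r' invf_div; field; rewrite gt_eqF.
have := integrated (U `^ (r - 1)) (V `^ (r - 1)) (powR_ge0 _ _) (powR_ge0 _ _).
rewrite (mulrC _ U) (mulrC _ V) !mulr_powRB1//.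
have e z : (z `^ (r - 1)) `^ r' = z `^ r.
  by rewrite -powRrM /r'; congr (_ `^ _); rewrite mulrC divfK// gt_eqF.
rewrite !e; set D := U `^ r + V `^ r => DP.
(* Divide D <= D^(1/r') 2^(1/r) P by D^(1/r') and take r-th powers. *)
have D0 : 0 <= D by rewrite addr_ge0 ?powR_ge0.
have [->|Dneq0] := eqVneq D 0; first by rewrite mulr_ge0 ?powR_ge0.
have D1 : 0 < D by rewrite lt_neqAle eq_sym Dneq0.
have DE : D = D `^ r'^-1 * D `^ r^-1.
  by rewrite -powRD ?rr ?powRr1// Dneq0 implybT.
move: DP; rewrite {1}DE ler_pM2l ?powR_gt0// => DP.
have -> : D = (D `^ r^-1) `^ r by rewrite -powRrM mulVf ?powRr1// gt_eqF.
have -> : 2 * P `^ r = (2 `^ r^-1 * P) `^ r.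
  by rewrite powRM ?powR_ge0// -powRrM mulVf ?powRr1// gt_eqF.
by apply: ge0_ler_powR; rewrite ?nnegrE ?powR_ge0 ?mulr_ge0 ?powR_ge0// ltW.
Qed.

Section Lp.
Context d (T : measurableType d) (R : realType) (mu : {measure set T -> \bar R}).

Lemma rnorm_cLspace (p : \bar R) (p1 : (1 <= p)%E) (x : cLspace mu p1) :
  rnorm x = fine (cLnorm mu p (repr x)).
Proof. by []. Qed.

Lemma measurable_normc_powR (f : T -> R[i]) (r : R) : cmeasurable f ->
  measurable_fun [set: T] (fun t => Normc.normc (f t) `^ r).
Proof.
move=> mf; apply: (@measurableT_comp _ _ _ _ _ _ (@powR R ^~ r)) => //.
exact: measurable_normc.
Qed.

Lemma integral_normc_powR (r : R) (r1 : (1 <= r%:E)%E) (f : cLfun mu r1) :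
  (\int[mu]_t (Normc.normc (f t) `^ r)%:E
  = ((rnorm (cLclass f)) `^ r)%:E)%E.
Proof.
have r0 : r != 0 by rewrite gt_eqF// (lt_le_trans ltr01).
have -> : rnorm (cLclass f) = fine (cLnorm mu r%:E f).
  by apply: complexI; rewrite -rnormE -cLspace_normE.
rewrite -poweR_EFin fineK; last exact: cLnorm_fin.
rewrite /cLnorm (powR_Lnorm _ _ r0).
by apply: eq_integral => t _ /=; rewrite ger0_norm ?normc_ge0.
Qed.

(** Integrating the scalar inequality leaves the integral of
    (|f|^s + |g|^s)^(q/s), which Minkowski's inequality in L^(q/s) bounds by
    the (q/s)-th power of the sum of the norms of |f|^s and |g|^s in L^(q/s),
    that is, of the s-th powers of the norms of f and g in L^q. *)
Lemma clarkson_Lp_ge2 (q : R) (q1 : (1 <= q%:E)%E) : 2 <= q ->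
  clarkson_space (cLspace mu q1) (q / (q - 1)) q.
Proof.
move=> q2 x y; set s := q / (q - 1); set r := q / s.
have [q0 s0 rE r1] := conjugate_exponent q2; rewrite -/s -/r in s0 rE r1.
have {}r1 : 1 <= r by rewrite rE.
have r0 : 0 < r by exact: lt_le_trans r1.
pose f := repr x; pose g := repr y.
rewrite -(cLclassK x) -(cLclassK y) -/f -/g.
have [[mf _] [mg _]] := (cLfunP f, cLfunP g).
have -> : cLclass f - cLclass g = cLclass (f - g) by rewrite /cLclass raddfB.
rewrite -cLclassD -lee_fin EFinD -!integral_normc_powR.
pose nf t := Normc.normc (f t) `^ s; pose ng t := Normc.normc (g t) `^ s.
have mnf : measurable_fun [set: T] nf by exact: measurable_normc_powR.
have mng : measurable_fun [set: T] ng by exact: measurable_normc_powR.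
have [mfg _] := cLfunP (f + g); have [mfBg _] := cLfunP (f - g).
have mpow h : cmeasurable h ->
    measurable_fun [set: T] (fun t => (Normc.normc (h t) `^ q)%:E).
  by move=> mh; apply/measurable_EFinP; exact: measurable_normc_powR.
rewrite -ge0_integralD//; [|by move=> *; rewrite lee_fin powR_ge0|exact: mpow
  |by move=> *; rewrite lee_fin powR_ge0|exact: mpow].
have mpowr h : measurable_fun [set: T] h ->
    measurable_fun [set: T] (fun t => (h t `^ r)%:E).
  move=> mh; apply/measurable_EFinP.
  exact: (@measurableT_comp _ _ _ _ _ _ (@powR R ^~ r)).
have Nr (h : T -> R) : (forall t, 0 <= h t) ->
    ('N[mu]_r%:E[EFin \o h] `^ r = \int[mu]_t (h t `^ r)%:E)%E.
  move=> h0; rewrite powR_Lnorm; last by rewrite gt_eqF.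
  by apply: eq_integral => t _ /=; rewrite ger0_norm.
have nf0 t : 0 <= nf t by exact: powR_ge0.
have ng0 t : 0 <= ng t by exact: powR_ge0.
have Nnorm (h : cLfun mu q1) : ('N[mu]_r%:E[EFin \o (fun t => Normc.normc (h t) `^ s)%R]
    = ((rnorm (cLclass h)) `^ s)%:E)%E.
  rewrite -[LHS]poweRe1 ?Lnorm_ge0// -(mulfV (_ : r != 0)); last by rewrite gt_eqF.
  rewrite poweRrM Nr; last by move=> t; exact: powR_ge0.
  have -> : (\int[mu]_t ((Normc.normc (h t) `^ s) `^ r)%:E
           = \int[mu]_t (Normc.normc (h t) `^ q)%:E)%E.
    apply: eq_integral => t _; rewrite -powRrM /r mulrC divfK// gt_eqF//.
  rewrite integral_normc_powR poweR_EFin -powRrM; congr (_ `^ _)%:E.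
  by rewrite /r invf_div mulrCA divff ?mulr1// gt_eqF.
apply: (@le_trans _ _ (\int[mu]_t (2 * (nf t + ng t) `^ r)%:E)%E).
  apply: ge0_le_integral => //.
  - by move=> t _; rewrite adde_ge0// lee_fin powR_ge0.
  - by apply: emeasurable_funD; exact: mpow.
  - by apply/measurable_EFinP; apply: measurable_funM => //; apply/measurable_EFinP;
      apply: mpowr; exact: measurable_funD.
  - move=> t _; rewrite -EFinD lee_fin rE.
    exact: clarkson_complex.
under eq_integral => t _ do rewrite EFinM.
rewrite ge0_integralZl//; last 2 first.
- by apply: mpowr; exact: measurable_funD.
- by move=> t _; rewrite lee_fin powR_ge0.
rewrite EFinM.
rewrite lee_pmul2l//.
rewrite -[X in (_ <= X)%E]poweR_EFin.
rewrite EFinD.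
rewrite -(Nnorm f).
rewrite -(Nnorm g).
rewrite -(Nr (fun t => nf t + ng t)); last by move=> t; rewrite addr_ge0.
apply: gt0_ler_poweR; rewrite ?in_itv/= ?leey ?andbT ?adde_ge0 ?Lnorm_ge0//.
  exact: ltW.
exact: minkowski_EFin.
Qed.

(** Here q/s > 1 acts outside the integrals over |f + g|^s and |f - g|^s.  By
    duality it suffices to bound their combinations with coefficients
    al, be >= 0; for these the two-term Hoelder inequality and the scalar
    Clarkson inequality give a pointwise bound, which integrates. *)
Lemma clarkson_Lp_le2 (q s : R) (s1 : (1 <= s%:E)%E) : 2 <= q -> s = q / (q - 1) ->
  clarkson_space (cLspace mu s1) s q.
Proof.
rewrite le_eqVlt => /predU1P[<-|q2] sE.
  have s2 : s = 2 by rewrite sE; field.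
  have ss : s / (s - 1) = s by rewrite s2; field.
  have := @clarkson_Lp_ge2 s s1; rewrite ss -s2; apply; exact: lexx.
move=> x y; pose r := q / s.
have [q0 s0 rE _] := conjugate_exponent (ltW q2); rewrite -sE -/r in s0 rE.
have r1 : 1 < r by rewrite rE ltrBrDr.
have r0 : 0 < r by exact: lt_trans r1.
have r10 : 0 < r - 1 by rewrite subr_gt0.
pose r' := r / (r - 1).
have r'0 : 0 < r' by rewrite divr_gt0.
have rr : r'^-1 + r^-1 = 1 by rewrite /r' invf_div; field; rewrite gt_eqF.
pose f := repr x; pose g := repr y.
rewrite -(cLclassK x) -(cLclassK y) -/f -/g.
have [[mf _] [mg _]] := (cLfunP f, cLfunP g).
have -> : cLclass f - cLclass g = cLclass (f - g) by rewrite /cLclass raddfB.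
rewrite -cLclassD.
have [mfg _] := cLfunP (f + g); have [mfBg _] := cLfunP (f - g).
pose U := rnorm (cLclass (f + g)) `^ s; pose V := rnorm (cLclass (f - g)) `^ s.
pose P := rnorm (cLclass f) `^ s + rnorm (cLclass g) `^ s.
have U0 : 0 <= U by exact: powR_ge0.
have V0 : 0 <= V by exact: powR_ge0.
have P0 : 0 <= P by rewrite addr_ge0// powR_ge0.
have sr : s * r = q by rewrite /r mulrC divfK// gt_eqF.
have UE : rnorm (cLclass (f + g)) `^ q = U `^ r by rewrite /U -powRrM sr.
have VE : rnorm (cLclass (f - g)) `^ q = V `^ r by rewrite /V -powRrM sr.
rewrite UE VE -/P -/r.
have pointwise (al be : R) (a b : R[i]) : 0 <= al -> 0 <= be ->
    al * Normc.normc (a + b) `^ s + be * Normc.normc (a - b) `^ s <=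
    (al `^ r' + be `^ r') `^ r'^-1 *
      (2 `^ r^-1 * (Normc.normc a `^ s + Normc.normc b `^ s)).
  move=> al0 be0.
  have := hoelder2 al0 be0 (powR_ge0 (Normc.normc (a + b)) s)
    (powR_ge0 (Normc.normc (a - b)) s) r'0 r0 rr.
  move=> /le_trans; apply; rewrite ler_wpM2l ?powR_ge0// -!powRrM sr.
  have ri0 : 0 <= r^-1 by rewrite invr_ge0 ltW.
  have := clarkson_complex a b (ltW q2).
  move=> /(ge0_ler_powR ri0); rewrite !nnegrE => H.
  apply: le_trans (H _ _) _.
  - by rewrite addr_ge0 ?powR_ge0.
  - by rewrite mulr_ge0 ?powR_ge0.
  rewrite -sE powRM ?powR_ge0// -rE -powRrM mulfV ?powRr1//; last by rewrite gt_eqF.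
  by rewrite addr_ge0 ?powR_ge0.
have integrated (al be : R) : 0 <= al -> 0 <= be ->
    al * U + be * V <= (al `^ r' + be `^ r') `^ r'^-1 * (2 `^ r^-1 * P).
  move=> al0 be0; set K := _ `^ r'^-1.
  have K0 : 0 <= K by exact: powR_ge0.
  have M0 : 0 <= 2 `^ r^-1 :> R by exact: powR_ge0.
  rewrite mulrA /P -lee_fin EFinD !EFinM EFinD -!integral_normc_powR.
  have mpow h : cmeasurable h ->
      measurable_fun [set: T] (fun t => (Normc.normc (h t) `^ s)%:E).
    by move=> mh; apply/measurable_EFinP; exact: measurable_normc_powR.
  have pos (h : T -> R[i]) t : [set: T] t -> (0 <= (Normc.normc (h t) `^ s)%:E)%E.
    by move=> _; rewrite lee_fin powR_ge0.
  rewrite -!ge0_integralZl//; [|exact: mpow|exact: pos|exact: mpow|exact: pos].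
  rewrite -[X in (_ <= _ * X)%E]ge0_integralD//;
    [|exact: pos|exact: mpow|exact: pos|exact: mpow].
  rewrite -[X in (_ <= X)%E]ge0_integralZl//; last 3 first.
  - by apply: emeasurable_funD; exact: mpow.
  - by move=> t _; rewrite adde_ge0// pos.
  - by rewrite lee_fin mulr_ge0.
  rewrite -ge0_integralD//; last 4 first.
  - by move=> t _; rewrite mule_ge0// pos.
  - by apply: emeasurable_funM => //; exact: mpow.
  - by move=> t _; rewrite mule_ge0// pos.
  - by apply: emeasurable_funM => //; exact: mpow.
  apply: ge0_le_integral => //.
  - by move=> t _; rewrite adde_ge0// mule_ge0// pos.
  - by apply: emeasurable_funD; apply: emeasurable_funM => //; exact: mpow.
  - apply: emeasurable_funM => //; apply: emeasurable_funD; exact: mpow.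
  - move=> t _; have := pointwise al be (f t) (g t) al0 be0.
    by rewrite -lee_fin mulrA.
exact: two_term_duality integrated.
Qed.
End Lp.

(** * The extremal form on the sequence space l^p *)

Lemma continuous_contraction (R : realType) (X : normedModType R[i]) (f : X -> R[i]) :
  (forall x y, Normc.normc (f x - f y) <= rnorm (x - y)) ->
  continuous (f : X -> R[i]^o).
Proof.
move=> lf x; apply/cvgrPdist_lt => e e0; near=> y.
apply: (@le_lt_trans _ _ `|x - y|); last by near: y; exact: cvgr_dist_lt.
by have := lf x y; rewrite -lecR -rnormE.
Unshelve. all: by end_near. Qed.

Section little_lp.
Context (R : realType) (p : \bar R) (p1 : (1 <= p)%E).
Let mu : {measure set nat -> \bar R} := @counting nat R.
Let X : normedModType R[i] := cLspace mu p1.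

Lemma counting1 (i : nat) : mu [set i] = 1%E.
Proof.
rewrite /mu /= /counting asboolT//.
by rewrite fset_set1 finmap.cardfs1.
Qed.

(** Nonempty sets have counting measure at least 1, so the classes of l^p are
    functions and the coordinates below do not depend on representatives. *)
Lemma ae_counting (P : nat -> Prop) : {ae mu, forall t, P t} -> forall t, P t.
Proof.
move=> [B [mB B0 PB]] t; apply: contrapT => Pt.
have tB : [set t] `<=` B by move=> _ ->; exact: PB.
have : (mu [set t] <= mu B)%E by apply: le_measure; rewrite ?inE.
by rewrite B0 counting1 lee_fin ler10.
Qed.

Definition coordinate (x : X) (i : nat) : R[i] := (repr x : cLfun mu p1) i.

Lemma coordinate_class (f : cLfun mu p1) i : coordinate (cLclass f) i = f i.
Proof.
by apply: (@ae_counting (fun t => repr (cLclass f) t = f t)); exact: repr_cLclass.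
Qed.

Lemma coordinateZD a x y i :
  coordinate (a *: x + y) i = a * coordinate x i + coordinate y i.
Proof.
rewrite -[x in LHS](cLclassK x) -[y in LHS](cLclassK y).
by rewrite [_ *: _]cLscaleE -cLclassD coordinate_class.
Qed.

Lemma coordinateB x y i : coordinate (x - y) i = coordinate x i - coordinate y i.
Proof. by rewrite addrC -scaleN1r coordinateZD mulN1r addrC. Qed.

Lemma cLnorm_unit_vector (i : nat) :
  (cLnorm mu p (fun j => (j == i)%:R) <= 1)%E.
Proof.
have N (j : nat) : Normc.normc ((j == i)%:R : R[i]) = \1_[set i] j.
  rewrite normc_nat indicE (_ : (j \in [set i]) = (j == i))//.
  by apply/idP/eqP; rewrite in_setE.
rewrite /cLnorm unlock /Lnorm; case: p p1 => [r| |]//.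
- rewrite lee_fin => r1; have r0 : 0 < r by exact: lt_le_trans r1.
  have -> : (\int[mu]_x (`|(EFin \o (fun t => Normc.normc ((t == i)%:R : R[i]))) x| `^ r)
     = \int[mu]_x (\1_[set i] x)%:E)%E.
    apply: eq_integral => j _ /=; rewrite N ger0_norm//.
    by rewrite indicE; case: (_ \in _); rewrite ?powR1 ?powR0// gt_eqF.
  by rewrite integral_indic// setIT counting1 poweR1r.
- move=> _; case: ifPn => // _; apply/ess_supP; apply: nearW => j /=.
  by rewrite N indicE ger0_norm// lee_fin lern1; case: (_ \in _).
Qed.

Lemma unit_vector_cLfun (i : nat) :
  ((fun j => (j == i)%:R) : nat -> R[i]) \in cLfun_pred mu p1.
Proof.
apply/cLfunE; split; first by split.
by apply: le_lt_trans (cLnorm_unit_vector i) _; rewrite ltry.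
Qed.

Definition unit_vector (i : nat) : X := cLclass (CLfun (unit_vector_cLfun i)).

Lemma coordinate_unit_vector i j : coordinate (unit_vector i) j = (j == i)%:R.
Proof. exact: coordinate_class. Qed.

Lemma rnorm_unit_vector i : rnorm (unit_vector i) <= 1.
Proof.
have -> : rnorm (unit_vector i) = fine (cLnorm mu p (fun j => (j == i)%:R)).
    apply: complexI; rewrite -rnormE.
  exact: (cLspace_normE (CLfun (unit_vector_cLfun i))).
rewrite -lee_fin fineK ?cLnorm_unit_vector//.
exact: (cLnorm_fin (CLfun (unit_vector_cLfun i))).
Qed.

(** The norm is the full series, which dominates its partial sums. *)
Lemma sum_coordinate_powR (r : R) (x : X) n : p = r%:E ->
  \sum_(i < n) Normc.normc (coordinate x i) `^ r <= rnorm x `^ r.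
Proof.
rewrite /coordinate; move: x; rewrite /X; case: p p1 => // s s1 x [sr]; subst s.
rewrite -lee_fin -{2}(cLclassK x) -integral_normc_powR.
rewrite (@ge0_integral_count _ (fun t => (Normc.normc (repr x t) `^ r)%:E)); last first.
  by move=> j; rewrite lee_fin powR_ge0.
rewrite -sumEFin -(big_mkord xpredT (fun i => (Normc.normc (repr x i) `^ r)%:E)).
by apply: nneseries_lim_ge => j _ _; rewrite lee_fin powR_ge0.
Qed.

Lemma normc_coordinate (x : X) i : Normc.normc (coordinate x i) <= rnorm x.
Proof.
have [[r pr]|py] : (exists r, p = r%:E) \/ p = +oo%E.
  by case: p p1 => [r| |] //; [left; exists r|right].
  have r1 : 1 <= r by rewrite -lee_fin -pr.
  have r0 : 0 < r by exact: lt_le_trans r1.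
  have := sum_coordinate_powR x i.+1 pr; rewrite big_ord_recr /= => H.
  have {}H : Normc.normc (coordinate x i) `^ r <= rnorm x `^ r.
    apply: le_trans H; rewrite lerDr sumr_ge0// => j _; exact: powR_ge0.
  have ri : 0 <= r^-1 by rewrite invr_ge0 ltW.
  move: H => /(ge0_ler_powR ri); rewrite !nnegrE !powR_ge0 => /(_ isT isT).
  by rewrite -!powRrM mulfV ?gt_eqF// !powRr1 ?normc_ge0 ?rnorm_ge0.
rewrite /coordinate; move: x; rewrite /X; case: p p1 py => // oo1 _ x.
rewrite rnorm_cLspace -lee_fin fineK ?cLnorm_fin// /cLnorm Lnorm.unlock.
have -> : (0 < mu [set: nat])%E.
  apply: (@lt_le_trans _ _ (mu [set i])); first by rewrite counting1.
  by apply: le_measure; rewrite ?inE.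
have := @ess_sup_ge _ _ _ mu (abse \o (EFin \o (fun t => Normc.normc (repr x t)))).
by move=> /ae_counting /(_ i) /=; rewrite ger0_norm ?normc_ge0.
Qed.

Lemma coordinate_continuous i :
  continuous ((fun x : X => coordinate x i) : X -> R[i]^o).
Proof.
by apply: continuous_contraction => x y; rewrite -coordinateB; exact: normc_coordinate.
Qed.

End little_lp.

Lemma continuous_prod (R : realType) (T : topologicalType) (I : Type) (r : seq I)
    (f : I -> T -> R[i]^o) : (forall i, continuous (f i)) ->
  continuous (fun x => \prod_(i <- r) f i x : R[i]^o).
Proof.
move=> cf; elim: r => [|i r IH] x.
  by under eq_fun do rewrite big_nil; exact: cvg_cst.
rewrite (_ : (fun x => _) = f i * (fun z => \prod_(j <- r) f j z)).
  by apply: (continuousM (cf i x) (IH x)).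
by apply/funext => z; rewrite big_cons.
Qed.

Lemma continuous_bigsum (R : realType) (T : topologicalType) (I : Type) (r : seq I)
    (P : pred I) (f : I -> T -> R[i]^o) : (forall i, continuous (f i)) ->
  continuous (fun x => \sum_(i <- r | P i) f i x : R[i]^o).
Proof.
move=> cf; elim: r => [|i r IH] x.
  by under eq_fun do rewrite big_nil; exact: cvg_cst.
case Pi : (P i).
  rewrite (_ : (fun x => _) = f i + (fun z => \sum_(j <- r | P j) f j z)).
    by apply: (continuousD (cf i x) (IH x)).
  by apply/funext => z; rewrite big_cons Pi.
rewrite (_ : (fun x => _) = (fun z => \sum_(j <- r | P j) f j z)).
  exact: IH.
by apply/funext => z; rewrite big_cons Pi.
Qed.

(** The arithmetic-geometric inequality for the m numbers m t_i / k_i, each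
    repeated k_i times, the positions being the letters of the word of k. *)
Lemma weighted_AGM (R : realFieldType) n (k : 'I_n -> nat) (t : 'I_n -> R) :
  (0 < \sum_i k i)%N -> (forall i, 0 <= t i) -> \sum_i t i <= 1 ->
  \prod_i t i ^+ k i
    <= (\prod_i k i ^ k i)%N%:R / ((\sum_i k i) ^ (\sum_i k i))%N%:R.
Proof.
move=> m0 t0 t1; set m := (\sum_i k i)%N in m0 *.
have mR : 0 < m%:R :> R by rewrite ltr0n.
have kk : 0 < (\prod_i k i ^ k i)%N%:R :> R.
  by rewrite ltr0n prodn_gt0// => i; rewrite expn_gt0; case: (k i).
pose c i := m%:R * t i / (k i)%:R.
have c0 i : 0 <= c i by rewrite divr_ge0 ?mulr_ge0.
have := @leif_AGM R 'I_m xpredT (fun j => c (tnth (word_tuple k) j)) (fun j _ => c0 _).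
move=> /leifP/=; set lhs := \prod_(_ in _) _; set rhs := (_ / _) ^+ _ => H.
have {H} : lhs <= rhs by case: ifP H => _ => [/eqP->|/ltW].
have -> : lhs = \prod_i c i ^+ k i by rewrite -prod_word.
rewrite {}/rhs card_ord => H.
have sumc : (\sum_(j < m) c (tnth (word_tuple k) j)) / m%:R <= 1.
  rewrite -(big_tuple _ _ _ xpredT) val_word_tuple sum_seq_count.
  rewrite ler_pdivrMr// mul1r.
  apply: (@le_trans _ _ (\sum_i m%:R * t i)); last first.
    by rewrite -mulr_sumr ler_piMr.
  apply: ler_sum => i _; rewrite count_word /c.
  have [ki|ki] := eqVneq (k i) 0%N; first by rewrite ki mulr0n mulr_ge0.
  by rewrite -[_ *+ k i]mulr_natr divfK// pnatr_eq0.
have {}H : \prod_i c i ^+ k i <= 1.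
  apply: le_trans H _; apply: exprn_ile1 => //.
  by rewrite divr_ge0// sumr_ge0.
have -> : \prod_i t i ^+ k i = (\prod_i c i ^+ k i) *
    ((\prod_i k i ^ k i)%N%:R / (m ^ m)%N%:R).
  rewrite natr_prod natrX /m -prodrXr -prodf_div -big_split /=; apply: eq_bigr => i _.
  rewrite natrX -/m -expr_div_n -exprMn /c.
  have [->|ki] := eqVneq (k i) 0%N; first by rewrite !expr0.
  by rewrite mulrA divfK ?pnatr_eq0// mulrAC divff ?mul1r// gt_eqF.
by rewrite ler_piMl// divr_ge0.
Qed.
Lemma continuous_div_cst (R : realType) (T : topologicalType) (f : T -> R[i]^o)
    (c : R[i]) : continuous f -> continuous (fun x => f x / c : R[i]^o).
Proof. by move=> cf x; apply: cvgM; [exact: cf|exact: cvg_cst]. Qed.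

(** The symmetrization of the monomial prod_i x_i^(k_i): averaging over the
    rearrangements of the word of k, rather than over all permutations of the
    coordinates, makes its value at the unit vectors a single term. *)
Definition extremal_form (R : realType) (p : \bar R) (p1 : (1 <= p)%E)
    n (k : 'I_n -> nat)
    (x : 'I_(\sum_i k i)%N -> cLspace (@counting nat R) p1) : R[i] :=
  (\sum_(t : (\sum_i k i)%N.-tuple 'I_n | perm_eq t (word k))
      \prod_j coordinate (x j) (tnth t j))
  / (multinomial k)%:R.

Section extremal.
Context (R : realType) (p : \bar R) (p1 : (1 <= p)%E) (n : nat) (k : 'I_n -> nat).
Local Notation m := (\sum_i k i)%N.
Local Notation L := (@extremal_form R p p1 n k).
Local Notation C := (multinomial k).
Let X : normedModType R[i] := cLspace (@counting nat R) p1.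

Lemma multinomial_gt0 : (0 < C)%N.
Proof. by apply/card_gt0P; exists (word_tuple k); rewrite inE val_word_tuple. Qed.

Lemma extremal_multilinear : @multilinear_form R X m L.
Proof.
move=> x j a u v.
have E w (t : m.-tuple 'I_n) : \prod_l coordinate (dfwith x j w l : X) (tnth t l) =
    coordinate w (tnth t j) * \prod_(l | l != j) coordinate (x l) (tnth t l).
  rewrite (bigD1 j)//= dfwithin; congr (_ * _); apply: eq_bigr => l lj.
  by rewrite dfwithout// eq_sym.
rewrite /extremal_form mulrA -mulrDl; congr (_ / _).
rewrite mulr_sumr -big_split /=; apply: eq_bigr => t _.
by rewrite !E coordinateZD mulrDl mulrA.
Qed.

Lemma extremal_symmetric : @Defs.symmetric_form R X m L.
Proof.
move=> s x; rewrite /extremal_form; congr (_ / _).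
pose act (s : 'S_m) (t : m.-tuple 'I_n) := [tuple tnth t (s j) | j < m].
have actK : cancel (act s^-1%g) (act s).
  by move=> t; apply: eq_from_tnth => j; rewrite !tnth_mktuple permK.
rewrite [RHS](reindex_inj (can_inj actK)) /=; apply: eq_big => [t|t _].
  have /seq.permPl -> // : perm_eq (act s^-1%g t) t.
  by apply/tuple_permP; exists s^-1%g.
rewrite [RHS](reindex_inj (@perm_inj _ s)) /=; apply: eq_bigr => j _.
by rewrite tnth_mktuple permK.
Qed.

Lemma extremal_continuous : @continuous_form R X m L.
Proof.
apply: continuous_div_cst.
apply: continuous_bigsum => t; apply: continuous_prod => j y.
apply: (@continuous_comp {ptws 'I_m -> X} X R[i]^o (fun z => z j)
  (fun z => coordinate z (tnth t j))).
  exact: (@proj_continuous _ (fun=> X) j).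
exact: coordinate_continuous.
Qed.

Lemma extremal_hat (x : X) : hat L x = \prod_(i < n) coordinate x i ^+ k i.
Proof.
rewrite /hat /extremal_form.
rewrite (eq_bigr (fun=> \prod_(i < n) coordinate x i ^+ k i)).
  rewrite big_const iter_addr_0 -[X in X / _]mulr_natr mulfK//.
  by rewrite pnatr_eq0 -lt0n multinomial_gt0.
move=> t tw; rewrite (prod_tuple_count t (fun i : 'I_n => coordinate x i)).
by apply: eq_bigr => i _; rewrite (seq.permP tw) count_word.
Qed.

Lemma extremal_hat_norm :
  (0 < m)%N ->
  (hat_norm L <= (((\prod_i k i ^ k i)%N%:R / (m ^ m)%N%:R) `^ fine p^-1%E)%:E)%E.
Proof.
move=> m0; apply: ge_ereal_sup => _ [x /unit_ballP x1 <-].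
rewrite lee_fin extremal_hat normc_prod.
rewrite (eq_bigr (fun i : 'I_n => Normc.normc (coordinate x i) ^+ k i)); last first.
  by move=> i _; apply: normc_eq; rewrite normrX rmorphXn.
have [[r pr]|py] : (exists r, p = r%:E) \/ p = +oo%E.
  by case: p p1 => [r| |] //; [left; exists r|right].
- have r1 : 1 <= r by rewrite -lee_fin -pr.
  have r0 : 0 < r by exact: lt_le_trans r1.
  have -> : fine p^-1%E = r^-1 by rewrite pr inver gt_eqF.
  pose t i := Normc.normc (coordinate x i) `^ r.
  have t0 (i : 'I_n) : 0 <= t i by exact: powR_ge0.
  have t1 : \sum_(i < n) t i <= 1.
    apply: le_trans (sum_coordinate_powR x n pr) _.
    have <- : 1 `^ r = 1 :> R by rewrite powR1.
    by apply: ge0_ler_powR; rewrite ?nnegrE ?rnorm_ge0// ltW.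
  have := weighted_AGM m0 t0 t1.
  have ri : 0 <= r^-1 by rewrite invr_ge0 ltW.
  move=> /(ge0_ler_powR ri); rewrite !nnegrE => H.
  apply: le_trans (H _ _); last 2 first.
  + by apply: prodr_ge0 => i _; exact: exprn_ge0.
  + by rewrite divr_ge0.
  rewrite -powR_prod; last by move=> i; exact: exprn_ge0.
  apply: ler_prod => i _; rewrite exprn_ge0 ?normc_ge0//=.
  have -> : t i ^+ k i = (Normc.normc (coordinate x i) ^+ k i) `^ r.
    by rewrite /t powR_exprn ?normc_ge0.
  by rewrite -powRrM mulfV ?gt_eqF// powRr1// exprn_ge0 ?normc_ge0.
- have -> : fine p^-1%E = 0 by rewrite py invey.
  rewrite powRr0; apply: prodr_ile1 => i _.
  rewrite exprn_ge0 ?normc_ge0//= exprn_ile1 ?normc_ge0//.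
  exact: le_trans (normc_coordinate x i) x1.
Qed.

(** Evaluated at the unit vectors in the order of the word of k, only the word of k
    itself gives a nonzero product. *)
Lemma extremal_unit_vectors :
  L (@repeat_args R X n k (fun i => unit_vector p1 i)) = C%:R^-1.
Proof.
rewrite repeat_argsE /extremal_form -[RHS]mul1r; congr (_ / _).
rewrite (bigD1 (word_tuple k)) ?val_word_tuple//= big1 ?big1 ?addr0//.
  move=> t /andP[_ tw]; have [j tj] : exists j, tnth t j != tnth (word_tuple k) j.
    apply/existsP; apply: contraR tw; rewrite negb_exists => /forallP H.
    by apply/eqP/eq_from_tnth => j; apply/eqP; rewrite -[_ == _]negbK.
  rewrite (bigD1 j)//= coordinate_unit_vector.
  by rewrite (negbTE (_ : tnth t j != _ :> nat))// mul0r.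
by move=> j _; rewrite coordinate_unit_vector eqxx.
Qed.

Lemma polarization_bound_le_lp : (0 < m)%N ->
  ((polarization_bound k p)%:E <= polarization_const X k)%E.
Proof.
move=> m0; apply: le_ereal_inf_tmp => _ [M [M0 MP] <-].
have kk : 0 < (\prod_i k i ^ k i)%N%:R :> R.
  by rewrite ltr0n prodn_gt0// => i; rewrite expn_gt0; case: (k i).
have kf : 0 < (\prod_i (k i)`!)%N%:R :> R.
  by rewrite ltr0n prodn_gt0// => i; exact: fact_gt0.
have mm : 0 < (m ^ m)%:R :> R by rewrite ltr0n expn_gt0 m0.
have C0 : 0 < C%:R :> R by rewrite ltr0n multinomial_gt0.
have mult : C%:R * (\prod_i (k i)`!)%N%:R = (m`!)%:R :> R.
  by rewrite -natrM multinomial_fact.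
have := MP L (And3 extremal_multilinear extremal_symmetric extremal_continuous).
move=> H.
set A := ((\prod_i k i ^ k i)%N%:R / (m ^ m)%N%:R) `^ fine p^-1%E.
have A0 : 0 < A by rewrite powR_gt0// divr_gt0.
have {}H : ((C%:R^-1)%:E <= (M * A)%:E)%E.
  have <- : Normc.normc (L (@repeat_args R X n k (fun i => unit_vector p1 i))) = C%:R^-1.
    rewrite extremal_unit_vectors; apply: normc_eq.
    by rewrite normfV normr_nat fmorphV rmorph_nat.
  apply: le_trans (_ : _ <= M%:E * hat_norm L)%E _; last first.
    by rewrite EFinM lee_pmul2l// extremal_hat_norm.
  apply: le_trans H; apply: ereal_sup_ubound.
  exists (fun i => unit_vector p1 i) => // i.
  by apply/unit_ballP; exact: rnorm_unit_vector.
rewrite lee_fin in H; rewrite lee_fin /polarization_bound.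
have -> : ((m ^ m)%:R / (\prod_i k i ^ k i)%N%:R) `^ fine p^-1%E = A^-1 :> R.
  by rewrite -[_ / _]invf_div powRV// divr_ge0 ?ltW.
have -> : (\prod_i (k i)`!)%N%:R / (m`!)%:R = C%:R^-1 :> R.
  by rewrite -mult; field; rewrite !gt_eqF.
by rewrite mulrC ler_pdivrMr.
Qed.
End extremal.

Lemma polarization_bound_degree1 (R : realType) n (k : 'I_n -> nat) (p : \bar R) :
  (\sum_i k i)%N = 1%N -> polarization_bound k p = 1.
Proof.
move=> k1; have k01 i : k i = 0%N \/ k i = 1%N.
  have : (k i <= 1)%N by rewrite -k1 (bigD1 i)//= leq_addr.
  by case: (k i) => [|[|]]; [left|right|].
have kkE : (\prod_i k i ^ k i = 1)%N.
  by rewrite big1// => i _; case: (k01 i) => ->.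
have kfE : (\prod_i (k i)`! = 1)%N.
  by rewrite big1// => i _; case: (k01 i) => ->.
by rewrite /polarization_bound k1 kkE kfE divr1 powR1 mulr1.
Qed.

(** * The two bounds and their sharpness *)

Local Open Scope ereal_scope.

Theorem theorem6 (R : realType) (n m : nat) (k : 'I_n -> nat)
    (hm : (1 <= m)%N) (hk : (\sum_(i < n) k i)%N = m)
    (p : \bar R) (p1 : 1 <= p) :
  (forall (d : measure_display) (T : measurableType d)
      (mu : {measure set T -> \bar R}),
    (p <= hoelder_conjugate m%:R%:E ->
      polarization_const (cLspace mu p1) k <= (polarization_bound k p)%:E) /\
    (m%:R%:E <= p ->
      polarization_const (cLspace mu p1) k
        <= (polarization_bound k (hoelder_conjugate p))%:E)) /\
  (p <= hoelder_conjugate m%:R%:E ->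
    forall c : R,
      (forall (d : measure_display) (T : measurableType d)
          (mu : {measure set T -> \bar R}),
        polarization_const (cLspace mu p1) k <= c%:E) ->
      (polarization_bound k p <= c)%R).
Proof.
have m0 : (0 < \sum_i k i)%N by rewrite hk.
split; last first.
  move=> _ c /(_ _ _ (@counting nat R)); rewrite -lee_fin.
  exact/le_trans/polarization_bound_le_lp.
move=> d T mu; have [m1|m2] := leqP m 1.
  have k1 : (\sum_i k i)%N = 1%N by apply/eqP; rewrite hk eqn_leq m1.
  by split=> _; rewrite polarization_bound_degree1//
      -(polarization_bound_degree1 1%:E k1); exact: polarization_const_le_trivial.
have conjE (r : R) : (1 < r)%R -> hoelder_conjugate r%:E = (r / (r - 1))%:E.
  move=> r1; rewrite /hoelder_conjugate/= eqe gt_eqF ?(lt_trans ltr01)//.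
  by rewrite -EFinB inver subr_eq0 gt_eqF.
have mR2 : (2 <= m%:R :> R)%R by rewrite ler_nat.
have mR1 : (1 < m%:R :> R)%R by rewrite ltr1n.
split.
  case: p p1 => [r| |] //; last by rewrite conjE.
  move=> r1; rewrite conjE// lee_fin => rm.
  have r1' : (1 <= r)%R by rewrite -lee_fin.
  have r0 : (0 < r)%R by exact: lt_le_trans r1'.
  have [r11|rneq1] := eqVneq r 1%R.
    by subst r; exact: polarization_const_le_trivial.
  have rgt1 : (1 < r)%R by rewrite lt_neqAle eq_sym rneq1.
  have r10 : (0 < r - 1)%R by rewrite subr_gt0.
  (* The conjugate exponent q of r; r <= m' amounts to m <= q. *)
  have [q [mq rE]] : exists q : R, (m%:R <= q)%R /\ r = (q / (q - 1))%R.
    exists (r / (r - 1))%R; split.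
      by move: rm; rewrite !ler_pdivlMr ?subr_gt0//; lra.
    by field; rewrite gt_eqF//=; apply/eqP; lra.
  have q2 : (2 <= q)%R by exact: le_trans mq.
  have rq : (r <= q)%R by rewrite rE; exact: conjugate_exponent_le.
  apply: (polarization_const_le_clarkson m0 r0 rq); first by rewrite hk.
  exact: clarkson_Lp_le2.
case: p p1 => [q| |] // => [q1|oo1 _]; last first.
  by rewrite hoelder_conjugatey; exact: polarization_const_le_trivial.
rewrite lee_fin => mq.
have q2 : (2 <= q)%R by exact: le_trans mq.
have [q0 s0 _ _] := conjugate_exponent q2.
rewrite conjE; last by exact: lt_le_trans mq.
apply: (polarization_const_le_clarkson (q := q)) => //.
- exact: conjugate_exponent_le.
- by rewrite hk.
- exact: clarkson_Lp_ge2.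
Qed.
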